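(* Let $\{X_{n,t}:1\le t\le n,\ n\in\mathbb{N}\}$ be a triangular array of random variables with values in some measure space $\mathcal{X}$. Let $\mathcal{F}$ be a class of measurable functions $\mathcal{X}\to\mathbb{R}$ with $E|\varphi(X_{n,t})|<\infty$ for all $\varphi\in\mathcal{F}$, $1\le t\le n$, $n\in\mathbb{N}$. Assume that there are a real number $\gamma>0$ and an even integer $Q\ge 2$ such that the following hold. (A1) The array $\{X_{n,t}\}$ is strongly mixing with mixing coefficient $\alpha(\cdot)$ satisfying $$\sum_{t=1}^{\infty}t^{Q-2}\alpha(t)^{\frac{\gamma}{2+\gamma}}<\infty .$$ (A2) With $\rho(\varphi):=\sup_{n\in\mathbb{N}}\sup_{1\le t\le n}E[|\varphi(X_{n,t})|^2]^{1/2}$ for measurable $\varphi:\mathcal{X}\to\mathbb{R}$, $$\int_{0}^{1}x^{-\frac{\gamma}{2+\gamma}}\left(N_{[\,]}(x,\mathcal{F},\rho)\right)^{\frac{1}{Q}}dx<\infty ,$$ and, furthermore, for each $\varepsilon>0$ the bounding class $\mathcal{B}$ (in the definition of the bracketing number $N_{[\,]}(\varepsilon,\mathcal{F},\rho)$) can be chosen such that for all $i=2,\dots,Q$ $$\sup_{n\in\mathbb{N}}\sup_{1\le t\le n}E\left[|b(X_{n,t})|^{i\frac{2+\gamma}{2}}\right]^{\frac12}\le\varepsilon\quad\text{for all } b\in\mathcal{B}.$$ Then, with $$d(\varphi,\psi):=\sup_{n\in\mathbb{N}}\sup_{1\le t\le n}E\left[|\varphi(X_{n,t})-\psi(X_{n,t})|^{Q\frac{2+\gamma}{2}}\right]^{\frac{1}{Q}\frac{2}{2+\gamma}},$$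 it holds that $$\lim_{\delta\searrow 0}\limsup_{n\to\infty}E^*\left[\sup_{\{\varphi,\psi\in\mathcal{F}:\,d(\varphi,\psi)<\delta\}}\left|G_n(1,\varphi)-G_n(1,\psi)\right|^Q\right]^{\frac1Q}=0 .$$
   Context: Empirical process: for measurable $\varphi:\mathcal{X}\to\mathbb{R}$ and $s\in[0,1]$, $G_n(s,\varphi):=\frac{1}{\sqrt n}\sum_{i=1}^{\lfloor ns\rfloor}\left(\varphi(X_{n,i})-E[\varphi(X_{n,i})]\right)$, $n\in\mathbb{N}$. $E^*$ denotes outer expectation. Strong mixing: for a triangular array $\{X_{n,t}:1\le t\le n,n\in\mathbb{N}\}$ let, for $t\le n-1$, $$\alpha_n(t):=\sup_{1\le k\le n-t}\ \sup_{A\in\sigma(X_{n,j}:1\le j\le k),\ B\in\sigma(X_{n,j}:k+t\le j\le n)}|P(A\cap B)-P(A)P(B)|,$$ and $\alpha_n(t):=0$ for $t\ge n$. Let $\alpha(t):=\sup_{n\in\mathbb{N}}\alpha_n(t)$ for $t\in\mathbb{N}$ and $\alpha(0):=1$. The array is called strongly mixing if $\alpha(t)\to0$ as $t\to\infty$, and $\alpha(\cdot)$ is called its mixing coefficient. Bracketing number: for $\varepsilon>0$, $N_{[\,]}(\varepsilon,\mathcal{F},\rho)$ is the smallest integer $N$ for which there exist a class $\mathcal{B}$ of (measurable) functions $\mathcal{X}\to\mathbb{R}$, called bounding class, and a class $\mathcal{A}\subset\mathcal{F}$, called approximating class, such that $|\mathcal{B}|=|\mathcal{A}|=N$, $\rho(b)<\varepsilon$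 for all $b\in\mathcal{B}$, and for every $\varphi\in\mathcal{F}$ there exist $a^*\in\mathcal{A}$ and $b^*\in\mathcal{B}$ with $|\varphi-a^*|\le b^*$ (pointwise). It is $\infty$ if no such integer exists. The choice of the bounding class in (A2) is among the classes $\mathcal{B}$ that, together with some approximating class $\mathcal{A}$, satisfy these requirements with $N=N_{[\,]}(\varepsilon,\mathcal{F},\rho)$. *)

(* Defs.v *)
From HB Require Import structures.
From mathcomp Require Import all_boot all_order all_algebra.
From mathcomp Require Import all_classical all_reals all_analysis.
From mathcomp Require Import measurable_realfun.

Set Implicit Arguments.
Unset Strict Implicit.
Unset Printing Implicit Defensive.

Import Order.TTheory GRing.Theory Num.Theory.
Import numFieldNormedType.Exports.

Local Open Scope classical_set_scope.
Local Open Scope ring_scope.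

(* A triangular array is a map [X : nat -> nat -> Omega -> S] of which only the
   entries [X n t] with [1 <= t <= n] are relevant. *)

Definition array_sup (R : realType) (f : nat -> nat -> \bar R) : \bar R :=
  ereal_sup [set f nt.1 nt.2 | nt in [set nt : nat * nat | (1 <= nt.2 <= nt.1)%N]].

Section triangular_array.
Local Open Scope ereal_scope.
Context {R : realType} {dO dS : measure_display}.
Context {Omega : measurableType dO} {S : measurableType dS}.
Variables (P : probability Omega R) (X : nat -> nat -> Omega -> S).

(* The sigma-algebra generated by the [X n j] with [i <= j <= k]. *)
Definition array_sigma (n i k : nat) : set (set Omega) :=
  <<s \bigcup_(j in [set j : nat | (i <= j <= k)%N])
        preimage_set_system setT (X n j) measurable >>.

Definition alpha_row (n t : nat) : \bar R :=
  if (t < n)%N then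
    ereal_sup [set a | exists k A B,
      [/\ (1 <= k <= n - t)%N, array_sigma n 1 k A, array_sigma n (k + t) n B &
          a = `|P (A `&` B) - P A * P B|] ]
  else 0.

Definition alpha_mixing (t : nat) : \bar R :=
  if t is 0%N then 1 else ereal_sup (range (fun n => alpha_row n t)).

Definition strongly_mixing : Prop := alpha_mixing t @[t --> \oo] --> 0.

Definition empirical_process (n : nat) (s : R) (phi : S -> R) (w : Omega) : R :=
  ((Num.sqrt n%:R)^-1 * \sum_(1 <= i < (Num.truncn (n%:R * s)).+1)
     (phi (X n i w) - fine 'E_P[phi \o X n i]))%R.

(* [E[|phi(X_{n,t})|^p]] is taken in the extended reals, so the suprema below
   may be [+oo]. *)
Definition array_rho (phi : S -> R) : \bar R :=
  array_sup (fun n t => 'E_P[fun w => (`|phi (X n t w)| ^+ 2)%R] `^ (2^-1)%R).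

Definition array_dist (Q : nat) (gamma : R) (phi psi : S -> R) : \bar R :=
  array_sup (fun n t =>
    'E_P[fun w => (`|phi (X n t w) - psi (X n t w)|
                     `^ (Q%:R * ((2 + gamma) / 2)))%R]
      `^ (Q%:R^-1 * (2 / (2 + gamma)))%R).

End triangular_array.

Section bracketing.
Context {R : realType} {dS : measure_display} {S : measurableType dS}.

(* [B] is a bounding class and [A] an approximating class for [F], with
   [N] elements each. *)
Definition bracketing_classes (eps : R) (F : set (S -> R))
    (rho : (S -> R) -> \bar R) (N : nat) (B A : set (S -> R)) : Prop :=
  [/\ B `<=` [set b | measurable_fun setT b] /\ A `<=` F,
      (B #= `I_N)%card /\ (A #= `I_N)%card,
      forall b, B b -> (rho b < eps%:E)%E &
      forall phi, F phi -> exists a b,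
        [/\ A a, B b & forall x, `|phi x - a x| <= b x] ].

(* The infimum of the empty set is [+oo]. *)
Definition bracketing_number (eps : R) (F : set (S -> R))
    (rho : (S -> R) -> \bar R) : \bar R :=
  ereal_inf [set N%:R%:E | N in
    [set N : nat | exists B A, bracketing_classes eps F rho N B A] ].

End bracketing.

Section outer_expectation.
Local Open Scope ereal_scope.
Context {R : realType} {dO : measure_display} {Omega : measurableType dO}.

(* The disjunction says that the expectation of [U] exists. *)
Definition outer_expectation (P : probability Omega R) (Z : Omega -> \bar R)
    : \bar R :=
  ereal_inf [set \int[P]_w U w | U in
    [set U : Omega -> \bar R |
      [/\ measurable_fun setT U,
          \int[P]_w U^\+ w < +oo \/ \int[P]_w U^\- w < +oo &
          forall w, Z w <= U w] ] ].

End outer_expectation.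

(* Main.v *)
Require Import Defs.
From HB Require Import structures.
From mathcomp Require Import all_boot all_order all_algebra.
From mathcomp Require Import all_classical all_reals all_analysis.
From mathcomp Require Import measurable_realfun.
From mathcomp Require Import ring lra zify.

Set Implicit Arguments.
Unset Strict Implicit.
Unset Printing Implicit Defensive.

Import Order.TTheory GRing.Theory Num.Theory.
Import numFieldNormedType.Exports.

Local Open Scope classical_set_scope.
Local Open Scope ring_scope.

(** The proof is chaining over brackets, driven by a moment inequality for
    sums of mixing variables.

    Moment inequality ([Ex_sum_pow_le]).  Expanding the Q-th power of a sum of
    n centred variables [Z_i] gives the mixed moments of all maps
    [f : 'I_Q -> 'I_n].  Take the largest gap r between consecutive values of
    f.  It splits the factors into an early and a late block, and the mixed
    moment is the product of the moments of the two blocks up to a covariance,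
    which mixing bounds by a constant times [alpha(r)^kappa * theta^2], with
    [kappa = g / (2 + g)] and theta the size of the variables ([cov_prod]).
    The covariance bound needs no inequality for conjugate exponents: all
    factors are clamped at one level M, chosen so that the error of the
    clamping (by the moment of order [m(2+g)/2] of each factor) and the
    covariance of the clamped products (by mixing) have the same order.
    At most of order [n * r^(Q-2)] maps have largest gap r, since two values
    differ by exactly r and the others lie within Q r of them
    ([card_gap_pattern]); so the summability of [r^(Q-2) * alpha(r)^kappa]
    bounds all covariances together by a multiple of [n * theta^2].  Induction
    on the number of factors then gives a bound of order
    [(sqrt n * theta)^Q] as soon as [n * theta^2 >= 1]
    ([mixed_moment_sum_le]), that is, the empirical process of a function of
    size theta has norm of order theta in L^Q ([Lnorm_le_empirical]).

    Chaining ([chaining_bound]).  At level k use brackets of size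
    [eps_k = 2^-k], whose moments correspond to
    [theta_k = eps_k^(2/(2+g))].  A class of N functions costs a factor
    [N^(1/Q)] ([Lnorm_le_max]), and as every approximating function of level
    k+1 is tied to a single one of level k, the links of all levels from k0 to
    K cost at most a multiple of the sum of [N_k^(1/Q) * theta_k], a tail of a
    series that converges by the entropy condition
    ([entropy_sum_bounded]).  The chain is stopped at the last level K with
    [n * theta_K^2 >= 1]; the brackets of this level add the bias
    [sqrt n * eps_K], which is small because [eps_K] is a power larger than 1
    of [theta_K] ([bias_at_finest_level]).  What is left is a maximum over
    pairs of functions of level k0.  For each pair reached by some phi and psi
    at distance less than delta, one fixed such phi and psi stand for the
    pair: their difference has size of order delta, so the maximum costs
    [N_k0^(2/Q) * delta].  First k0 is taken large, then delta small, then n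
    large. *)

(** * Real-valued expectations *)

Section expectation_toolbox.
Context {R : realType} {d : measure_display} {T : measurableType d}.
Variable P : probability T R.
Implicit Types f g : T -> R.

Definition intble f := P.-integrable setT (EFin \o f).
(** Real-valued, so that products and sums of expectations need no case of an
    infinite value; meaningful for [intble] functions. *)
Definition Ex f : R := \int[P]_w f w.

Lemma intble_meas f : intble f -> measurable_fun setT f.
Proof. by move=> /integrableP[/measurable_EFinP]. Qed.

Lemma intble_le f g : measurable_fun setT f ->
  (forall w, `|f w| <= g w) -> intble g -> intble f.
Proof.
move=> mf fg ig; apply: le_integrable ig => //; first exact/measurable_EFinP.
move=> w _ /=; rewrite lee_fin (le_trans (fg w))//.
exact: ler_norm.
Qed.

Lemma intble_cst c : intble (fun=> c).
Proof. exact: (finite_measure_integrable_cst P c). Qed.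

Lemma intbleD f g : intble f -> intble g -> intble (fun w => f w + g w).
Proof. by move=> fi gi; exact: (integrableD _ fi gi). Qed.

Lemma intbleZ c f : intble f -> intble (fun w => c * f w).
Proof. by move=> fi; exact: (@integrableZl _ _ _ P setT _ c (EFin \o f)). Qed.

Lemma intble_norm f : intble f -> intble (fun w => `|f w|).
Proof. exact: integrable_norm. Qed.

Lemma intble_sum I (r : seq I) (p : pred I) (F : I -> T -> R) :
  (forall i, p i -> intble (F i)) -> intble (fun w => \sum_(i <- r | p i) F i w).
Proof.
move=> Fi; rewrite /intble.
rewrite (_ : EFin \o _ = fun w => \sum_(i <- r | p i) (EFin \o F i) w)%E.
  exact: integrable_sum.
by apply/funext => w; rewrite /= -sumEFin.
Qed.

Lemma intble_bounded f c : measurable_fun setT f -> (forall w, `|f w| <= c) ->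
  intble f.
Proof. by move=> mf fc; apply: (intble_le mf fc); exact: intble_cst. Qed.

Lemma Ex_ge0 f : (forall w, 0 <= f w) -> 0 <= Ex f.
Proof. by move=> f0; apply: Rintegral_ge0 => w _. Qed.

Lemma Ex_le f g : intble f -> intble g -> (forall w, f w <= g w) ->
  Ex f <= Ex g.
Proof. by move=> fi gi fg; apply: le_Rintegral => // w _. Qed.

Lemma Ex_cst c : Ex (fun=> c) = c.
Proof. by rewrite /Ex Rintegral_cst// [X in fine X](probability_setT P) mulr1. Qed.

Lemma ExD f g : intble f -> intble g -> Ex (fun w => f w + g w) = Ex f + Ex g.
Proof. exact: RintegralD. Qed.

Lemma ExB f g : intble f -> intble g -> Ex (fun w => f w - g w) = Ex f - Ex g.
Proof. exact: RintegralB. Qed.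

Lemma ExZ c f : intble f -> Ex (fun w => c * f w) = c * Ex f.
Proof. exact: RintegralZl. Qed.

Lemma Ex_norm f : intble f -> `|Ex f| <= Ex (fun w => `|f w|).
Proof. exact: le_normr_Rintegral. Qed.

Lemma Ex_sum I (r : seq I) (p : pred I) (F : I -> T -> R) :
  (forall i, p i -> intble (F i)) ->
  Ex (fun w => \sum_(i <- r | p i) F i w) = \sum_(i <- r | p i) Ex (F i).
Proof.
move=> Fi; elim: r => [|i r IH].
  rewrite big_nil -[RHS](Ex_cst 0); congr Ex; apply/funext => w.
  by rewrite big_nil.
rewrite big_cons -IH; case: ifPn => pi.
  rewrite -ExD; [|exact: Fi|exact: intble_sum].
  by congr Ex; apply/funext => w; rewrite big_cons pi.
by congr Ex; apply/funext => w; rewrite big_cons (negbTE pi).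
Qed.

Lemma Ex_norm_le f g : measurable_fun setT f -> intble g ->
  (forall w, `|f w| <= g w) -> `|Ex f| <= Ex g.
Proof.
move=> mf ig fg; have fi := intble_le mf fg ig.
rewrite (le_trans (Ex_norm fi))// Ex_le//; exact: intble_norm.
Qed.

Lemma Ex_indic (A : set T) : measurable A -> Ex \1_A = fine (P A).
Proof. by move=> mA; rewrite /Ex /Rintegral integral_indic// setIT. Qed.

Lemma intble_indic (A : set T) : measurable A -> intble \1_A.
Proof. by move=> mA; exact: (integrable_indic P mA). Qed.

End expectation_toolbox.

(** * Covariances of bounded variables *)

Section bounded_covariance.
Context {R : realType} {d : measure_display} {T : measurableType d}.
Variable P : probability T R.
Implicit Types U V : T -> R.

(** The number of levels 0, 1, ... below x is x rounded up.  Hence a variable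
    with values in the unit interval is, up to 1/N, the mean of the indicators
    of N of its level sets. *)
Lemma count_levels (N : nat) (x : R) : 0 <= x ->
  Num.min x N%:R <= \sum_(i < N) (i%:R < x)%R%:R <= x + 1.
Proof.
move=> x0; elim: N => [|N /andP[IH1 IH2]].
  by rewrite big_ord0 ge_min lexx orbT addr_ge0.
have leN : \sum_(i < N) (i%:R < x)%R%:R <= N%:R :> R.
  rewrite -[leRHS](_ : \sum_(i < N) 1 = _) ?ler_sum// => [i _|].
    by case: (_ < _).
  by rewrite sumr_const card_ord.
rewrite big_ord_recr /=; case: ltP => [Nx|xN].
  move: IH1; rewrite min_r ?(ltW Nx)// => IH1.
  by rewrite mulr1n ge_min -natr1 !lerD2r IH1 orbT/= (le_trans leN)// ltW.
move: IH1; rewrite min_l // => IH1.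
by rewrite mulr0n addr0 IH2 andbT ge_min IH1.
Qed.

(** Both variables are replaced by means of indicators of level sets; the
    covariance of the means is a mean of the quantities bounded by a, and the
    replacement costs a multiple of 1/N. *)
Lemma cov_unit_interval U V (a : R) :
  measurable_fun setT U -> measurable_fun setT V ->
  (forall w, 0 <= U w <= 1) -> (forall w, 0 <= V w <= 1) ->
  (forall u v, `|fine (P ([set w | u < U w] `&` [set w | v < V w]))
       - fine (P [set w | u < U w]) * fine (P [set w | v < V w])| <= a) ->
  `|Ex P (fun w => U w * V w) - Ex P U * Ex P V| <= a.
Proof.
move=> mU mV U01 V01 Ha.
(* W rounded up to a multiple of 1/N *)
pose disc (N : nat) (W : T -> R) w : R :=
  N%:R^-1 * \sum_(i < N) \1_[set w | i%:R / N%:R < W w] w.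
have mlev (W : T -> R) u : measurable_fun setT W -> measurable [set w : T | u < W w].
  move=> mW; rewrite -[X in measurable X]setTI.
  rewrite (_ : [set w | _] = W @^-1` `]u, +oo[); last first.
    by apply/seteqP; split => w /=; rewrite in_itv/= andbT.
  exact: mW.
have idisc N (W : T -> R) : measurable_fun setT W -> intble P (disc N W).
  move=> mW; apply: intbleZ; apply: intble_sum => i _.
  by apply: intble_indic; exact: mlev.
have discP N (W : T -> R) w : (0 < N)%N -> 0 <= W w <= 1 ->
    W w <= disc N W w <= W w + N%:R^-1.
  move=> N0 /andP[W0 W1]; have N0' : 0 < N%:R :> R by rewrite ltr0n.
  have := count_levels N (mulr_ge0 (ltW N0') W0).
  rewrite min_l ?ler_piMr ?(ltW N0')//.
  have -> : \sum_(i < N) (i%:R < N%:R * W w)%R%:R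
     = \sum_(i < N) \1_[set w | i%:R / N%:R < W w] w :> R.
    apply: eq_bigr => i _; rewrite indicE; congr (nat_of_bool _)%:R.
    apply/idP/idP => [h|/set_mem/=]; first apply/mem_set; rewrite /=.
      by rewrite ltr_pdivrMr // mulrC.
    by rewrite ltr_pdivrMr // mulrC.
  move=> /andP[h1 h2]; rewrite /disc ler_pdivlMl// h1/=.
  by rewrite ler_pdivrMl // mulrDr mulfV ?lt0r_neq0.
have covN N : (0 < N)%N ->
   `|Ex P (fun w => disc N U w * disc N V w) - Ex P (disc N U) * Ex P (disc N V)|
     <= a.
  move=> N0; have N0' : 0 < N%:R :> R by rewrite ltr0n.
  pose A i := [set w | i%:R / N%:R < U w]; pose B i := [set w | i%:R / N%:R < V w].
  have mA i : measurable (A i) by exact: mlev.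
  have mB i : measurable (B i) by exact: mlev.
  have -> : Ex P (disc N U) = N%:R^-1 * \sum_(i < N) fine (P (A i)).
    rewrite ExZ; last by apply: intble_sum => i _; apply: intble_indic; exact: mA.
    rewrite Ex_sum; last by move=> i _; apply: intble_indic; exact: mA.
    by congr (_ * _); apply: eq_bigr => i _; rewrite Ex_indic//; exact: mA.
  have -> : Ex P (disc N V) = N%:R^-1 * \sum_(i < N) fine (P (B i)).
    rewrite ExZ; last by apply: intble_sum => i _; apply: intble_indic; exact: mB.
    rewrite Ex_sum; last by move=> i _; apply: intble_indic; exact: mB.
    by congr (_ * _); apply: eq_bigr => i _; rewrite Ex_indic//; exact: mB.
  have -> : Ex P (fun w => disc N U w * disc N V w) =
      N%:R^-1 ^+ 2 * \sum_(i < N) \sum_(j < N) fine (P (A i `&` B j)).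
    rewrite (_ : (fun w => _) = fun w => N%:R^-1 ^+ 2 *
       \sum_(i < N) \sum_(j < N) \1_(A i `&` B j) w); last first.
      apply/funext => w; rewrite /disc mulrACA -expr2; congr (_ * _).
      rewrite mulr_suml; apply: eq_bigr => i _; rewrite mulr_sumr.
      by apply: eq_bigr => j _; rewrite indicI.
    have iAB i j : intble P \1_(A i `&` B j).
      by apply: intble_indic; exact: measurableI.
    rewrite ExZ; last by do 2 (apply: intble_sum => ? _).
    congr (_ * _); rewrite Ex_sum; last by move=> i _; exact: intble_sum.
    apply: eq_bigr => i _; rewrite Ex_sum//; apply: eq_bigr => j _.
    by rewrite Ex_indic//; exact: measurableI.
  rewrite mulrACA -expr2 -mulrBr mulr_suml -sumrB normrM.
  rewrite ger0_norm ?exprn_ge0 ?invr_ge0 ?(ltW N0')//.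
  rewrite exprVn ler_pdivrMl ?exprn_gt0//.
  apply: (le_trans (ler_norm_sum _ _ _)).
  rewrite -[leRHS](_ : \sum_(i < N) \sum_(j < N) a = _); last first.
    by rewrite !sumr_const !card_ord -mulrnA -[LHS]mulr_natl natrM expr2.
  apply: ler_sum => i _; rewrite mulr_sumr -sumrB.
  apply: (le_trans (ler_norm_sum _ _ _)); apply: ler_sum => j _.
  exact: Ha.
have iU : intble P U.
  apply: (intble_bounded P (c := 1) mU) => w.
  by have /andP[h0 h1] := U01 w; rewrite ger0_norm.
have iV : intble P V.
  apply: (intble_bounded P (c := 1) mV) => w.
  by have /andP[h0 h1] := V01 w; rewrite ger0_norm.
have iUV : intble P (fun w => U w * V w).
  apply: (intble_bounded P (c := 1)); first exact: measurable_funM.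
  move=> w; have /andP[h0 h1] := U01 w; have /andP[h2 h3] := V01 w.
  by rewrite ger0_norm ?mulr_ge0// mulr_ile1.
apply/ler_addgt0Pr => e e0.
have [N N0 Ne] : exists2 N, (0 < N)%N & 6 * N%:R^-1 <= e.
  exists (Num.truncn (6 / e)).+1 => //.
  rewrite ler_pdivrMr ?ltr0n// mulrC -ler_pdivrMr //.
  by rewrite ltW// truncnS_gt.
have N1 : N%:R^-1 <= 1 :> R by rewrite invf_le1 ?ler1n ?ltr0n.
have NV0 : 0 <= N%:R^-1 :> R by rewrite invr_ge0.
set h : R := N%:R^-1 in Ne N1 NV0 discP *.
have near (W : T -> R) (mW : measurable_fun setT W) (W01 : forall w, 0 <= W w <= 1) :
    [/\ 0 <= Ex P W <= 1 & Ex P W <= Ex P (disc N W) <= Ex P W + h].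
  have iW : intble P W.
    apply: (intble_bounded P (c := 1) mW) => w.
    by have /andP[h0 h1] := W01 w; rewrite ger0_norm.
  split; apply/andP; split.
  - by apply: Ex_ge0 => w; have /andP[] := W01 w.
  - rewrite -[leRHS](Ex_cst P 1); apply: Ex_le => //; first exact: intble_cst.
    by move=> w; have /andP[] := W01 w.
  - apply: Ex_le => //; first exact: idisc.
    by move=> w; have /andP[] := discP N W w N0 (W01 w).
  - rewrite -[in leRHS](Ex_cst P h) -ExD//; last exact: intble_cst.
    apply: Ex_le => //; [exact: idisc|by apply: intbleD => //; exact: intble_cst|].
    by move=> w; have /andP[] := discP N W w N0 (W01 w).
have mdisc (W : T -> R) : measurable_fun setT W -> measurable_fun setT (disc N W).
  by move=> mW; exact: intble_meas (idisc N W mW).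
have nUV : Ex P (fun w => U w * V w) <= Ex P (fun w => disc N U w * disc N V w)
    <= Ex P (fun w => U w * V w) + 3 * h.
  have iDD : intble P (fun w => disc N U w * disc N V w).
    apply: (intble_bounded P (c := 4)).
      by apply: measurable_funM; exact: mdisc.
    move=> w.
    have /andP[a1 a2] := discP N U w N0 (U01 w).
    have /andP[b1 b2] := discP N V w N0 (V01 w).
    have /andP[h0 h1] := U01 w; have /andP[h2 h3] := V01 w.
    rewrite -/h in a2 b2.
    have du : disc N U w <= 2 by lra.
    have dv : disc N V w <= 2 by lra.
    rewrite ger0_norm; last by apply: mulr_ge0; lra.
    have := ler_pM (le_trans h0 a1) (le_trans h2 b1) du dv; lra.
  apply/andP; split.
    apply: Ex_le => // w.
    have /andP[a1 a2] := discP N U w N0 (U01 w).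
    have /andP[b1 b2] := discP N V w N0 (V01 w).
    have /andP[h0 h1] := U01 w; have /andP[h2 h3] := V01 w.
    by apply: ler_pM.
  rewrite -[in leRHS](Ex_cst P (3 * h)) -ExD//; last exact: intble_cst.
  apply: Ex_le => //; first by apply: intbleD => //; exact: intble_cst.
  move=> w.
  have /andP[a1 a2] := discP N U w N0 (U01 w).
  have /andP[b1 b2] := discP N V w N0 (V01 w).
  have /andP[h0 h1] := U01 w; have /andP[h2 h3] := V01 w.
  rewrite -/h in a2 b2 *.
  have := ler_pM (le_trans h0 a1) (le_trans h2 b1) a2 b2; nra.
have := covN N N0.
have [/andP[u0 u1] /andP[u2 u3]] := near U mU U01.
have [/andP[v0 v1] /andP[v2 v3]] := near V mV V01.
move/andP: nUV => [c1 c2].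
have : `|Ex P (disc N U) * Ex P (disc N V) - Ex P U * Ex P V| <= 3 * h.
  rewrite ger0_norm ?subr_ge0 ?ler_pM//.
  have := ler_pM (le_trans u0 u2) (le_trans v0 v2) u3 v3; nra.
rewrite !ler_norml => /andP[p1 p2] /andP[q1 q2].
apply/andP; split; lra.
Qed.

(** The factor 4 comes from mapping the ranges of length 2 m1 and 2 m2 onto
    the unit interval. *)
Lemma cov_bounded U V (a m1 m2 : R) : 0 < m1 -> 0 < m2 ->
  measurable_fun setT U -> measurable_fun setT V ->
  (forall w, `|U w| <= m1) -> (forall w, `|V w| <= m2) ->
  (forall u v, `|fine (P ([set w | u < U w] `&` [set w | v < V w]))
       - fine (P [set w | u < U w]) * fine (P [set w | v < V w])| <= a) ->
  `|Ex P (fun w => U w * V w) - Ex P U * Ex P V| <= 4 * (m1 * m2) * a.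
Proof.
move=> m10 m20 mU mV Um Vm Ha.
pose U1 w := (2 * m1)^-1 * U w + 2^-1; pose V1 w := (2 * m2)^-1 * V w + 2^-1.
have mU1 : measurable_fun setT U1.
  by apply: measurable_funD => //; apply: measurable_funM.
have mV1 : measurable_fun setT V1.
  by apply: measurable_funD => //; apply: measurable_funM.
have unit01 (m x : R) : 0 < m -> `|x| <= m -> 0 <= (2 * m)^-1 * x + 2^-1 <= 1.
  move=> m0; rewrite ler_norml => /andP[x1 x2].
  have -> : (2 * m)^-1 * x + 2^-1 = (x + m) / (2 * m).
    by field; rewrite gt_eqF.
  by rewrite divr_ge0 ?ler_pdivrMr ?mulr_gt0//=; lra.
have U101 w : 0 <= U1 w <= 1 by exact: unit01.
have V101 w : 0 <= V1 w <= 1 by exact: unit01.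
have lev (m u x : R) : 0 < m -> (u < (2 * m)^-1 * x + 2^-1) = ((u - 2^-1) * (2 * m) < x).
  by move=> m0; rewrite -ltrBlDr mulrC ltr_pdivlMr// mulr_gt0.
have Ha1 u v : `|fine (P ([set w | u < U1 w] `&` [set w | v < V1 w]))
       - fine (P [set w | u < U1 w]) * fine (P [set w | v < V1 w])| <= a.
  have -> : [set w | u < U1 w] = [set w | (u - 2^-1) * (2 * m1) < U w].
    by apply/seteqP; split => w /=; rewrite lev.
  have -> : [set w | v < V1 w] = [set w | (v - 2^-1) * (2 * m2) < V w].
    by apply/seteqP; split => w /=; rewrite lev.
  exact: Ha.
have := cov_unit_interval mU1 mV1 U101 V101 Ha1.
have iU : intble P U by exact: (intble_bounded P mU Um).
have iV : intble P V by exact: (intble_bounded P mV Vm).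
have iUV : intble P (fun w => U w * V w).
  apply: (intble_bounded P (c := m1 * m2)); first exact: measurable_funM.
  by move=> w; rewrite normrM ler_pM.
have -> : Ex P (fun w => U1 w * V1 w) = (4 * (m1 * m2))^-1 * Ex P (fun w => U w * V w)
   + (4 * m1)^-1 * Ex P U + (4 * m2)^-1 * Ex P V + 4^-1.
  rewrite -[in RHS](Ex_cst P 4^-1) -!ExZ// -!ExD//.
  - congr Ex; apply/funext => w; rewrite /U1 /V1; field.
    by rewrite !gt_eqF.
  all: try by repeat apply: intbleD => //; first [exact: intbleZ | exact: intble_cst].
have -> : Ex P U1 = (2 * m1)^-1 * Ex P U + 2^-1.
  rewrite -[in RHS](Ex_cst P 2^-1) -!ExZ// -!ExD//; last exact: intble_cst.
  exact: intbleZ.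
have -> : Ex P V1 = (2 * m2)^-1 * Ex P V + 2^-1.
  rewrite -[in RHS](Ex_cst P 2^-1) -!ExZ// -!ExD//; last exact: intble_cst.
  exact: intbleZ.
rewrite (_ : _ - _ = (4 * (m1 * m2))^-1 * (Ex P (fun w => U w * V w) - Ex P U * Ex P V)).
  rewrite normrM ger0_norm ?invr_ge0 ?mulr_ge0 ?(ltW m10) ?(ltW m20)//.
  by rewrite ler_pdivrMl// !mulr_gt0.
by field; rewrite !gt_eqF.
Qed.

End bounded_covariance.

(** * Covariances of products of normalized variables *)

Section product_covariance.
Context {R : realType} {d : measure_display} {T : measurableType d}.
Variable P : probability T R.

Lemma measurable_fun_prod_in d' (T' : measurableType d') (D : finType)
    (S : {set D}) (z : D -> T' -> R) :
  (forall k, k \in S -> measurable_fun setT (z k)) ->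
  measurable_fun setT (fun w => \prod_(k in S) z k w).
Proof.
move=> mz; rewrite (_ : (fun w => _) = fun w => \prod_(k <- enum S) z k w).
  by apply: measurable_prod => k; rewrite mem_enum => /mz.
by apply/funext => w; rewrite big_enum.
Qed.

Definition clamp (x : R) : R := Num.max (-1) (Num.min x 1).

Lemma clamp_id x : `|x| <= 1 -> clamp x = x.
Proof.
by rewrite ler_norml => /andP[x1 x2]; rewrite /clamp min_l// max_r.
Qed.

Lemma clamp_le1 x : `|clamp x| <= 1.
Proof. by rewrite /clamp ler_norml le_max lexx ge_max ge_min lexx orbT/=; lra. Qed.

Lemma measurable_clamp d' (T' : measurableType d') (f : T' -> R) :
  measurable_fun setT f -> measurable_fun setT (clamp \o f).
Proof.
move=> mf; apply: (@measurable_maxr _ _ _ _ (fun=> -1)) => //.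
exact: (@measurable_minr _ _ _ _ f (fun=> 1)).
Qed.

(** The product is at most the power #|S| of its largest factor, and the
    latter is at least 1, so that its power s is larger still. *)
Lemma prod_le_sum_powR (D : finType) (S : {set D}) (y : D -> R) (s : R) k0 :
  (forall k, 0 <= y k) -> #|S|%:R <= s -> k0 \in S -> 1 <= y k0 ->
  \prod_(k in S) y k <= \sum_(k in S) y k `^ s.
Proof.
move=> y0 Ss k0S yk0; case: (arg_maxP y k0S) => k kS kmax.
have yk1 : 1 <= y k by apply: (le_trans yk0); exact: kmax.
apply: (@le_trans _ _ (y k ^+ #|S|)).
  by rewrite -prodr_const; apply: ler_prod => i iS; rewrite y0; exact: kmax.
apply: (@le_trans _ _ (y k `^ s)).
  by rewrite -powR_mulrn ?y0//; exact: ler_powR.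
rewrite (bigD1 k)//= lerDl sumr_ge0// => i _; exact: powR_ge0.
Qed.

Lemma prod_le_1_sum_powR (D : finType) (S : {set D}) (y : D -> R) (s : R) :
  (forall k, 0 <= y k) -> #|S|%:R <= s ->
  \prod_(k in S) y k <= 1 + \sum_(k in S) y k `^ s.
Proof.
move=> y0 Ss; have [/existsP[k0 /andP[k0S yk0]]|/existsPn no] :=
    boolP [exists k0, (k0 \in S) && (1 <= y k0)].
  by rewrite (le_trans (prod_le_sum_powR y0 Ss k0S yk0))// lerDr.
rewrite (@le_trans _ _ 1)//; last by rewrite lerDl sumr_ge0// => i _; exact: powR_ge0.
apply: prodr_ile1 => k kS; rewrite y0/=.
by have := no k; rewrite kS/= -ltNge => /ltW.
Qed.

(** Clamping changes the product only if some factor exceeds 1; then both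
    products are at most the sum. *)
Lemma clamp_prod_err (D : finType) (S : {set D}) (z : D -> R) (s : R) :
  #|S|%:R <= s ->
  `|\prod_(k in S) z k - \prod_(k in S) clamp (z k)|
     <= 2 * \sum_(k in S) `|z k| `^ s.
Proof.
move=> Ss; have [/existsP[k0 /andP[k0S yk0]]|/existsPn no] :=
    boolP [exists k0, (k0 \in S) && (1 <= `|z k0|)].
  rewrite (le_trans (ler_normB _ _))// mulr2n mulrDl mul1r lerD//.
    by rewrite normr_prod; apply: prod_le_sum_powR k0S yk0.
  rewrite normr_prod (@le_trans _ _ 1)//.
    by apply: prodr_ile1 => k kS; rewrite normr_ge0 clamp_le1.
  apply: (@le_trans _ _ (`|z k0| `^ s)).
    rewrite -[leLHS](powRr0 `|z k0|) ler_powR//.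
    by rewrite (le_trans _ Ss).
  rewrite (bigD1 k0)//= lerDl sumr_ge0// => i _; exact: powR_ge0.
rewrite (_ : \prod_(k in S) clamp (z k) = \prod_(k in S) z k).
  rewrite subrr normr0 mulr_ge0// sumr_ge0// => i _; exact: powR_ge0.
apply: eq_bigr => k kS; rewrite clamp_id//.
by have := no k; rewrite kS/= -ltNge => /ltW.
Qed.

Section normalized.
Variables (D : finType) (z : D -> T -> R) (s a : R).
Hypothesis mz : forall k, measurable_fun setT (z k).
Hypothesis Ds : #|D|%:R <= s.
Hypothesis a01 : 0 < a <= 1.
Hypothesis iz : forall k, intble P (fun w => `|z k w| `^ s).
Hypothesis Ez : forall k, Ex P (fun w => `|z k w| `^ s) <= a.
Let m : R := #|D|%:R.

Let Ss (S : {set D}) : #|S|%:R <= s.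
Proof. by rewrite (le_trans _ Ds)// ler_nat max_card. Qed.

Let isum (S : {set D}) : intble P (fun w => \sum_(k in S) `|z k w| `^ s).
Proof. exact: intble_sum. Qed.

Let Esum (S : {set D}) : Ex P (fun w => \sum_(k in S) `|z k w| `^ s) <= m * a.
Proof.
rewrite Ex_sum// (@le_trans _ _ (\sum_(k in S) a))//.
  exact: ler_sum.
have /andP[a0 _] := a01.
by rewrite sumr_const -mulr_natl ler_pM2r// ler_nat max_card.
Qed.

Let mprod (S : {set D}) : measurable_fun setT (fun w => \prod_(k in S) z k w).
Proof. exact: measurable_fun_prod_in. Qed.

Lemma intble_prod_normalized (S : {set D}) :
  intble P (fun w => \prod_(k in S) z k w).
Proof.
apply: (@intble_le _ _ _ _ _ (fun w => 1 + \sum_(k in S) `|z k w| `^ s)) => //.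
  by move=> w; rewrite normr_prod prod_le_1_sum_powR.
by apply: intbleD => //; exact: intble_cst.
Qed.

Lemma Ex_prod_normalized (S : {set D}) :
  `|Ex P (fun w => \prod_(k in S) z k w)| <= 1 + m * a.
Proof.
have ig : intble P (fun w => 1 + \sum_(k in S) `|z k w| `^ s).
  by apply: intbleD => //; exact: intble_cst.
apply: (@le_trans _ _ (Ex P (fun w => 1 + \sum_(k in S) `|z k w| `^ s))).
  by apply: Ex_norm_le => // w; rewrite normr_prod prod_le_1_sum_powR.
by rewrite ExD// ?Ex_cst ?lerD2l//; exact: intble_cst.
Qed.

Let cprod (S : {set D}) w := \prod_(k in S) clamp (z k w).

Let mcprod (S : {set D}) : measurable_fun setT (cprod S).
Proof.
by apply: measurable_fun_prod_in => k _; exact: measurable_clamp.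
Qed.

Let cprod1 (S : {set D}) w : `|cprod S w| <= 1.
Proof.
by rewrite normr_prod; apply: prodr_ile1 => k _; rewrite normr_ge0 clamp_le1.
Qed.

Let icprod (S : {set D}) : intble P (cprod S).
Proof. exact: (intble_bounded P (mcprod S) (cprod1 S)). Qed.

Let Ecprod (S : {set D}) :
  `|Ex P (fun w => \prod_(k in S) z k w) - Ex P (cprod S)| <= 2 * (m * a).
Proof.
rewrite -ExB//; last exact: intble_prod_normalized.
apply: (@le_trans _ _ (Ex P (fun w => 2 * \sum_(k in S) `|z k w| `^ s))).
  apply: Ex_norm_le => [||w]; [exact: measurable_funB|exact: intbleZ|].
  exact: clamp_prod_err.
by rewrite ExZ// ler_pM2l// Esum.
Qed.

(** After clamping, mixing bounds the covariance; the clamping itself costs a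
    multiple of a in each of the three expectations, because the moments of
    order s are at most a. *)
Lemma cov_prod_normalized (S : {set D}) :
  (forall u v, `|fine (P ([set w | u < \prod_(k in S) clamp (z k w)] `&`
                          [set w | v < \prod_(k in ~: S) clamp (z k w)]))
       - fine (P [set w | u < \prod_(k in S) clamp (z k w)]) *
         fine (P [set w | v < \prod_(k in ~: S) clamp (z k w)])| <= a) ->
  `|Ex P (fun w => \prod_k z k w)
     - Ex P (fun w => \prod_(k in S) z k w) * Ex P (fun w => \prod_(k in ~: S) z k w)|
   <= (2 * m ^+ 2 + 6 * m + 4) * a.
Proof.
have /andP[a0 a1] := a01; have m0 : 0 <= m by [].
move=> /(cov_bounded ltr01 ltr01 (mcprod S) (mcprod (~: S)) (cprod1 S) (cprod1 (~: S))).
rewrite !mulr1.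
have splitD (F : D -> R) : \prod_k F k = (\prod_(k in S) F k) * (\prod_(k in ~: S) F k).
  rewrite (bigID (fun k => k \in S))/=; congr (_ * _).
  by apply: eq_bigl => k; rewrite finset.in_setC.
have allT (F : D -> R) : \prod_k F k = \prod_(k in [set: D]%SET) F k.
  by apply: eq_bigl => k; rewrite finset.in_setT.
rewrite (_ : (fun w => cprod S w * cprod (~: S) w) = cprod [set: D]%SET); last first.
  by apply/funext => w; rewrite /cprod -splitD allT.
rewrite (_ : (fun w => \prod_k z k w) = fun w => \prod_(k in [set: D]%SET) z k w); last first.
  by apply/funext => w; rewrite allT.
have := Ecprod [set: D]%SET; have := Ecprod S; have := Ecprod (~: S).
have := Ex_prod_normalized (~: S).
have : `|Ex P (cprod S)| <= 1.
  rewrite -[leRHS](Ex_cst P 1); apply: Ex_norm_le => //; exact: intble_cst.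
set u := Ex P (fun w => \prod_(k in S) z k w).
set v := Ex P (fun w => \prod_(k in ~: S) z k w).
set w := Ex P (fun w => \prod_(k in _) z k w).
set u' := Ex P (cprod S); set v' := Ex P (cprod (~: S)).
set w' := Ex P (cprod _).
move=> hu' hv hvv' huu' hww' hc.
have -> : w - u * v = (w - w') + (w' - u' * v') - (u - u') * v - u' * (v - v').
  by ring.
rewrite (le_trans (ler_normB _ _))//.
have h1 : `|u' * (v - v')| <= 2 * (m * a).
  by rewrite normrM -[leRHS]mul1r ler_pM.
have h2 : `|(u - u') * v| <= 2 * (m * a) * (1 + m).
  rewrite normrM ler_pM// (le_trans hv)// lerD2l -[leRHS]mulr1 ler_wpM2l//.
rewrite (le_trans (lerD (ler_normB _ _) h1))//.
rewrite (le_trans (lerD (lerD (ler_normD _ _) h2) (lexx _)))//.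
rewrite (le_trans (lerD (lerD (lerD hww' hc) (lexx _)) (lexx _)))//.
by rewrite le_eqVlt; apply/orP; left; apply/eqP; ring.
Qed.

End normalized.
End product_covariance.

(** * Covariances of products of variables of size theta *)

Section scaled_covariance.
Context {R : realType} {d : measure_display} {T : measurableType d}.
Variable P : probability T R.
Variables (m : nat) (g theta : R) (Z : 'I_m -> T -> R).
Hypothesis m0 : (0 < m)%N.
Hypothesis g0 : 0 < g.
Hypothesis theta0 : 0 < theta.
Let s : R := m%:R * ((2 + g) / 2).
Hypothesis mZ : forall k, measurable_fun setT (Z k).
Hypothesis iZ : forall k, intble P (fun w => `|Z k w| `^ s).
Hypothesis EZ : forall k, Ex P (fun w => `|Z k w| `^ s) <= theta `^ (2 + g).

Definition cov_const (m : nat) : R := 2 * m%:R ^+ 2 + 6 * m%:R + 4.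

Let g2 : 0 < 2 + g. Proof. by rewrite addr_gt0. Qed.
Let s0 : 0 < s. Proof. by rewrite mulr_gt0 ?ltr0n ?divr_gt0. Qed.
Let scale (a : R) : R := (theta `^ (2 + g) / a) `^ s^-1.

Let scale_gt0 a : 0 < a -> 0 < scale a.
Proof. by move=> a0; rewrite powR_gt0// divr_gt0// powR_gt0. Qed.

Let scale_s a : 0 < a -> scale a `^ s = theta `^ (2 + g) / a.
Proof.
move=> a0; rewrite /scale -powRrM mulVf ?gt_eqF// powRr1//.
by rewrite divr_ge0 ?powR_ge0// ltW.
Qed.

Let scale_m a : 0 < a -> scale a ^+ m * a = a `^ (g / (2 + g)) * theta ^+ 2.
Proof.
move=> a0; rewrite -powR_mulrn ?(ltW (scale_gt0 a0))// /scale -powRrM.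
have -> : s^-1 * m%:R = 2 / (2 + g).
  by rewrite /s; field; rewrite !gt_eqF//= ltr0n.
rewrite powRM ?powR_ge0 ?invr_ge0 ?(ltW a0)// -powRrM.
have -> : (2 + g) * (2 / (2 + g)) = 2%:R by field; rewrite gt_eqF.
rewrite powR_mulrn ?(ltW theta0)// mulrC mulrCA mulrC; congr (_ * _).
rewrite -[a in a^-1]powRr1 ?(ltW a0)// -powRN -powRrM.
rewrite -[X in X * _]powRr1 ?(ltW a0)// -powRD ?(gt_eqF a0) ?implybT//.
by congr (_ `^ _); field; rewrite gt_eqF.
Qed.

Let z a k w := (scale a)^-1 * Z k w.

Let zs a k : 0 < a -> (fun w => `|z a k w| `^ s) =
  (fun w => (scale a `^ s)^-1 * `|Z k w| `^ s).
Proof.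
move=> a0; apply/funext => w; have h := scale_gt0 a0.
rewrite /z normrM ger0_norm ?invr_ge0 ?ltW// powRM ?invr_ge0 ?(ltW h)//.
by rewrite -[in LHS](powRr1 (ltW h)) -powRN -powRrM mulN1r powRN.
Qed.

Let iz a k : 0 < a -> intble P (fun w => `|z a k w| `^ s).
Proof. by move=> a0; rewrite zs//; exact: intbleZ. Qed.

Let Ez a k : 0 < a -> Ex P (fun w => `|z a k w| `^ s) <= a.
Proof.
move=> a0; rewrite zs// ExZ// scale_s//.
have t0 : 0 < theta `^ (2 + g) by rewrite powR_gt0.
rewrite ler_pdivrMl ?divr_gt0// (le_trans (EZ k))//.
by rewrite divfK// gt_eqF.
Qed.

Let mz a k : measurable_fun setT (z a k).
Proof. exact: measurable_funM. Qed.

Let ms : #|'I_m|%:R <= s.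
Proof.
rewrite card_ord /s -[leLHS]mulr1 ler_wpM2l// ler_pdivlMr// mul1r.
by rewrite lerDl ltW.
Qed.

Let prod_z a (S : {set 'I_m}) : 0 < a -> (fun w => \prod_(k in S) Z k w) =
  (fun w => scale a ^+ #|S| * \prod_(k in S) z a k w).
Proof.
move=> a0; apply/funext => w; rewrite big_split/= prodr_const mulrA.
by rewrite -exprMn mulfV ?expr1n ?mul1r// gt_eqF// scale_gt0.
Qed.

Lemma intble_prod (S : {set 'I_m}) : intble P (fun w => \prod_(k in S) Z k w).
Proof.
rewrite (prod_z S ltr01); apply: intbleZ.
apply: (@intble_prod_normalized _ _ _ P _ (z 1) s) => // k; exact: iz.
Qed.

(** A bound that uses no mixing; it is what [cov_prod] would give at rate
    1. *)
Lemma Ex_prod_le :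
  `|Ex P (fun w => \prod_k Z k w)| <= cov_const m * theta ^+ 2.
Proof.
have setTE w (F : 'I_m -> T -> R) : \prod_k F k w = \prod_(k in [set: 'I_m]%SET) F k w.
  by apply: eq_bigl => k; rewrite finset.in_setT.
rewrite (_ : (fun w => _) = fun w => \prod_(k in [set: 'I_m]%SET) Z k w); last first.
  by apply/funext => w; rewrite setTE.
rewrite (prod_z _ ltr01) ExZ; last first.
  apply: (@intble_prod_normalized _ _ _ P _ (z 1) s) => // k; exact: iz.
rewrite cardsT card_ord normrM ger0_norm ?exprn_ge0 ?(ltW (scale_gt0 ltr01))//.
have := scale_m ltr01; rewrite mulr1 powR1 mul1r => ->.
rewrite mulrC ler_pM2r ?exprn_gt0//.
have := @Ex_prod_normalized _ _ _ P _ (z 1) s 1 (mz 1) ms _ _ _ [set: 'I_m]%SET.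
rewrite lexx ltr01 => /(_ isT)/(_ (fun k => iz k ltr01))/(_ (fun k => Ez k ltr01)).
rewrite card_ord mulr1 => /le_trans; apply.
by rewrite /cov_const; have : 0 <= m%:R :> R := ler0n _ _; nra.
Qed.

Variables (G1 G2 : set (set T)) (S : {set 'I_m}).
Hypothesis G1Z : forall k, k \in S ->
  measurable_fun (setT : set (g_sigma_algebraType G1)) (Z k).
Hypothesis G2Z : forall k, k \notin S ->
  measurable_fun (setT : set (g_sigma_algebraType G2)) (Z k).

Let covZ := Ex P (fun w => \prod_k Z k w) -
  Ex P (fun w => \prod_(k in S) Z k w) * Ex P (fun w => \prod_(k in ~: S) Z k w).

(** Dividing by [scale a] makes the moments of order s at most a, which is
    what [cov_prod_normalized] asks for; multiplying back by the power m of
    [scale a] turns the bound a into the power of a in the statement. *)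
Lemma cov_prod_gt0 (a : R) : 0 < a <= 1 ->
  (forall A B, <<s G1 >> A -> <<s G2 >> B ->
    `|fine (P (A `&` B)) - fine (P A) * fine (P B)| <= a) ->
  `|covZ| <= cov_const m * (a `^ (g / (2 + g)) * theta ^+ 2).
Proof.
move=> a01 mix; have /andP[a0 a1] := a01.
have setTE w (F : 'I_m -> T -> R) : \prod_k F k w = \prod_(k in [set: 'I_m]%SET) F k w.
  by apply: eq_bigl => k; rewrite finset.in_setT.
have -> : covZ = scale a ^+ m * (Ex P (fun w => \prod_k z a k w)
   - Ex P (fun w => \prod_(k in S) z a k w) * Ex P (fun w => \prod_(k in ~: S) z a k w)).
  have iprod (S' : {set 'I_m}) : intble P (fun w => \prod_(k in S') z a k w).
    apply: (@intble_prod_normalized _ _ _ P _ (z a) s) => // k; exact: iz.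
  rewrite /covZ.
  rewrite (_ : (fun w => \prod_k Z k w) = fun w => \prod_(k in [set: 'I_m]%SET) Z k w); last first.
    by apply/funext => w; rewrite setTE.
  rewrite (_ : (fun w => \prod_k z a k w) = fun w => \prod_(k in [set: 'I_m]%SET) z a k w); last first.
    by apply/funext => w; rewrite setTE.
  rewrite !(prod_z _ a0) !ExZ// mulrACA -exprD mulrBr cardsT card_ord.
  by rewrite cardsC card_ord.
rewrite normrM ger0_norm ?exprn_ge0 ?(ltW (scale_gt0 a0))//.
rewrite -scale_m// mulrCA ler_pM2l ?exprn_gt0 ?scale_gt0//.
have Gz (G : set (set T)) (S' : {set 'I_m}) u :
  (forall k, k \in S' ->
     measurable_fun (setT : set (g_sigma_algebraType G)) (Z k)) ->
  <<s G >> [set w | u < \prod_(k in S') clamp (z a k w)].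
  move=> GZ.
  have mc : measurable_fun (setT : set (g_sigma_algebraType G))
      (fun w => \prod_(k in S') clamp (z a k w)).
    apply: measurable_fun_prod_in => k kS.
    apply: (@measurable_clamp _ _ (g_sigma_algebraType G) (z a k)).
    by apply: measurable_funM => //; exact: GZ.
  have := mc measurableT `]u, +oo[%classic (measurable_itv _).
  rewrite setTI (_ : _ @^-1` _ = [set w | u < \prod_(k in S') clamp (z a k w)])//.
  by apply/seteqP; split => w /=; rewrite in_itv/= andbT.
have := @cov_prod_normalized _ _ _ P _ (z a) s a (mz a) ms a01
  (fun k => iz k a0) (fun k => Ez k a0) S.
rewrite card_ord; apply => u v; apply: mix; apply: Gz => // k.
by rewrite finset.in_setC; exact: G2Z.
Qed.

(** At rate 0 the bound for all positive rates forces the covariance to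
    vanish. *)
Lemma cov_prod (a : R) : 0 <= a <= 1 ->
  (forall A B, <<s G1 >> A -> <<s G2 >> B ->
    `|fine (P (A `&` B)) - fine (P A) * fine (P B)| <= a) ->
  `|covZ| <= cov_const m * (a `^ (g / (2 + g)) * theta ^+ 2).
Proof.
move=> /andP[]; rewrite le_eqVlt => /predU1P[<- _ mix|a0 a1]; last first.
  by apply: cov_prod_gt0; rewrite a0.
have k0 : 0 < g / (2 + g) by rewrite divr_gt0.
have C0 : 0 < cov_const m.
  by rewrite /cov_const; have : 0 <= m%:R :> R := ler0n _ _; nra.
have Ct : 0 < cov_const m * theta ^+ 2 by rewrite mulr_gt0// exprn_gt0.
rewrite powR0 ?gt_eqF// mul0r mulr0 leNgt; apply/negP => x0.
set x := `|covZ| in x0.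
(* the rate at which the bound equals half of the covariance x *)
pose b := (x / (2 * (cov_const m * theta ^+ 2))) `^ (g / (2 + g))^-1.
have b0 : 0 < b by rewrite powR_gt0// divr_gt0// mulr_gt0.
have : x <= cov_const m * (Num.min b 1 `^ (g / (2 + g)) * theta ^+ 2).
  apply: cov_prod_gt0; first by rewrite lt_min b0 ltr01 ge_min lexx orbT.
  by move=> A B GA GB; rewrite (le_trans (mix A B GA GB))// le_min ler01 ltW.
apply/negP; rewrite -ltNge.
apply: (@le_lt_trans _ _ (x / 2)); last by lra.
apply: (@le_trans _ _ (cov_const m * (b `^ (g / (2 + g)) * theta ^+ 2))).
  rewrite ler_pM2l// ler_wpM2r ?exprn_ge0 ?(ltW theta0)//.
  rewrite ge0_ler_powR ?(ltW k0)// ?nnegrE ?le_min ?ler01 ?(ltW b0)//.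
  by rewrite ge_min lexx.
rewrite /b -powRrM mulVf ?gt_eqF// powRr1; last first.
  by rewrite divr_ge0 ?(ltW x0)// mulr_ge0 ?(ltW Ct).
rewrite le_eqVlt; apply/orP; left; apply/eqP; field.
by rewrite !gt_eqF.
Qed.

End scaled_covariance.

(** * Gaps of index maps *)

Section combinatorics.
Local Open Scope nat_scope.

(** Among all pairs of values with no value strictly between them, take one
    that is furthest apart.  Every value is reached from the least one by
    steps over such pairs, each step passing at least one more index; so the
    range is at most #|D| times the largest gap. *)
Lemma largest_gap (D : finType) (f : D -> nat) :
  (forall k l, f k = f l) \/
  exists i j, [/\ f i < f j, forall k, (f k <= f i) || (f j <= f k) &
                  forall k l, f k <= f l + #|D| * (f j - f i)].
Proof.
have [/existsP[k1 /existsP[k2 k12]]|/existsPn no] :=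
    boolP [exists k, exists l, f k < f l]; last first.
  left => k l; apply/eqP; rewrite eqn_leq leqNgt [X in _ && X]leqNgt.
  by have /existsPn := no k => /(_ l) ->; have /existsPn := no l => /(_ k) ->.
right.
pose gap (p : D * D) := (f p.1 < f p.2) &&
  [forall k, (f k <= f p.1) || (f p.2 <= f k)].
have pred_gap k k' : f k' < f k ->
    exists2 l, gap (l, k) & forall k', f k' < f k -> f k' <= f l.
  move=> k'k; have [l lk lmax] := @arg_maxnP _ k' (fun l => f l < f k) f k'k.
  exists l => //; rewrite /gap/= lk/=; apply/forallP => j.
  by case: (ltnP (f j) (f k)) => [/lmax/= ljl|]; rewrite ?orbT// [X in X || _]ljl.
have [l0 gap0 _] := pred_gap _ _ k12.
have [[i j] gapij maxij] := @arg_maxnP _ _ gap (fun p => f p.2 - f p.1) gap0.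
have /andP[/= ij /forallP/= ijP] := gapij; exists i, j; split=> // k l.
have [kmin _ minP] := @arg_minnP _ i (fun=> true) f isT.
have low := minP _ isT.
set r := f j - f i.
have key k' : f k' <= f kmin + #|[pred x | f x < f k']| * r.
  have [N] := ubnP (f k'); elim: N k' => // N IH k' /ltnSE k'N.
  have [|k'min] := ltnP (f kmin) (f k'); last by rewrite (leq_trans k'min)// leq_addr.
  move=> /pred_gap[x gapx xmax]; have /andP[/= xk' _] := gapx.
  have := maxij _ gapx; rewrite /= -/r => xr.
  have := IH x (leq_trans xk' k'N) => fx.
  have sub : #|[pred y | f y < f x]| < #|[pred y | f y < f k']|.
    apply: proper_card; apply/properP; split.
      by apply/fintype.subsetP => y; rewrite !inE => /ltn_trans; apply.
    by exists x; rewrite !inE ?ltnn.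
  have : #|[pred y | f y < f x]|.+1 * r <= #|[pred y | f y < f k']| * r.
    by rewrite leq_mul2r sub orbT.
  rewrite mulSn => h.
  have e : f k' <= r + f x by rewrite -[leqLHS](subnK (ltnW xk')) leq_add2r.
  by rewrite (leq_trans e)// (leq_trans (leq_add (leqnn r) fx))// addnCA leq_add2l.
by rewrite (leq_trans (key k))// leq_add ?low// leq_mul2r max_card orbT.
Qed.

(** What [largest_gap] says about a map f whose largest gap r lies between the
    values at i and j, weakened to the part that is used for counting. *)
Definition gap_pattern (m n r : nat) (i j : 'I_m) (f : {ffun 'I_m -> 'I_n}) :=
  (f j == f i + r :> nat) &&
  [forall k, (f k <= f i + m * r) && (f i <= f k + m * r)].

(** Once the value at i is chosen, the value at j is determined and each of
    the m - 2 others lies in a window of length 2 m r + 1. *)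
Lemma card_gap_pattern (m n r : nat) (i j : 'I_m) : i != j ->
  #|[pred f | @gap_pattern m n r i j f]| <= n * (2 * m * r + 1) ^ (m - 2).
Proof.
move=> ij.
pose B (c k : nat) := (k <= c + m * r) && (c <= k + m * r).
pose F (c : 'I_n) (k : 'I_m) : simpl_pred 'I_n :=
  if k == i then pred1 c else if k == j then [pred x : 'I_n | x == c + r :> nat]
  else [pred x : 'I_n | B c x].
have cardB (c : 'I_n) : #|[pred x : 'I_n | B c x]| <= 2 * m * r + 1.
  rewrite addn1 -[leqRHS]card_ord.
  have bnd (x : 'I_n) : x \in [pred x : 'I_n | B c x] ->
      c <= x + m * r /\ x + m * r - c < (2 * m * r).+1.
    by rewrite inE /B => /andP[h1 h2]; rewrite ltnS leq_subLR; split => //; nia.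
  apply: (leq_card_in (fun x : 'I_n => inord (x + m * r - c) : 'I_(2 * m * r).+1)).
  move=> x y /bnd[cx bx] /bnd[cy by_] /(congr1 val) /=; rewrite !inordK// => e.
  by apply: val_inj => /=; lia.
have sub : [pred f | @gap_pattern m n r i j f] \subset
    [pred f | [exists c, f \in family (F c)]].
  apply/fintype.subsetP => f; rewrite !inE => /andP[/eqP fj /forallP fk].
  apply/existsP; exists (f i); apply/familyP => k; rewrite /F.
  case: eqP => [->|_]; first by rewrite inE.
  by case: eqP => [->|_]; rewrite inE ?fj//; exact: fk.
rewrite (leq_trans (subset_leq_card sub))//.
apply: (@leq_trans (\sum_(c < n) #|family (F c)|)).
  under [leqRHS]eq_bigr do rewrite -sum1_card big_mkcond/=.
  rewrite exchange_big/= -sum1_card big_mkcond/=; apply: leq_sum => f _.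
  case: ifPn => // /existsP[c fc].
  by rewrite (bigD1 c)//= fc.
rewrite -[X in X * _]card_ord -sum_nat_const; apply: leq_sum => c _.
rewrite card_family foldrE big_image/= (bigD1 i)//= (bigD1 j)/=; last by rewrite eq_sym.
have -> : #|F c i| = 1 by rewrite /F eqxx card1.
have Fj : #|F c j| <= 1.
  rewrite /F eq_sym (negbTE ij) eqxx; apply/card_le1_eqP => x y.
  by rewrite !inE => /eqP xc /eqP yc; apply: val_inj; rewrite /= xc yc.
rewrite mul1n (leq_trans (leq_mul Fj (leqnn _)))// mul1n.
apply: (@leq_trans (\prod_(k | (k != i) && (k != j)) (2 * m * r + 1))).
  by apply: leq_prod => k /andP[ki kj]; rewrite /F (negbTE ki) (negbTE kj); exact: cardB.
rewrite prod_nat_const leq_eqVlt; apply/orP; left; apply/eqP; congr (_ ^ _).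
have h := cardC (pred2 i j); rewrite card2 ij card_ord in h.
rewrite -[in RHS]h addnC addnK; apply: eq_card => k.
by rewrite !inE negb_or.
Qed.

End combinatorics.

(** * Moments of sums of mixing variables *)

Ltac nneg := repeat first [done | exact: powR_ge0 | apply: exprn_ge0 |
  apply: addr_ge0 | apply: mulr_ge0].

Lemma leq_of_addnS (a b c : nat) : (a + b = c.+2 -> 0 < b -> a <= c.+1)%N.
Proof. lia. Qed.

Section mixed_moments.
Context {R : realType} {d : measure_display} {T : measurableType d}.
Variable P : probability T R.

Lemma sum_inj_le (I J : finType) (h : I -> J) (w : J -> R) :
  injective h -> (forall j, 0 <= w j) -> \sum_i w (h i) <= \sum_j w j.
Proof.
move=> hi w0.
have e : \sum_(j in imset h (mem [set: I]%SET)) w j = \sum_(i in [set: I]%SET) w (h i).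
  by apply: big_imset; exact: in2W.
rewrite [leLHS](eq_bigl (mem [set: I]%SET)) => [|i]; last by rewrite /= finset.in_setT.
rewrite -e.
by rewrite big_mkcond/=; apply: ler_sum => j _; case: ifP.
Qed.

Definition restrict_ffun (m n : nat) (S : {set 'I_m}) (f : {ffun 'I_m -> 'I_n}) :
  {ffun 'I_#|S| -> 'I_n} := [ffun i => f (enum_val i)].

(** A map is determined by its restrictions to S and to its complement, so the
    left-hand side is a part of the double sum on the right. *)
Lemma sum_restrict_le (m n : nat) (S : {set 'I_m})
    (u : {ffun 'I_#|S| -> 'I_n} -> R) (v : {ffun 'I_#|~: S| -> 'I_n} -> R) :
  (forall f, 0 <= u f) -> (forall f, 0 <= v f) ->
  \sum_f u (restrict_ffun S f) * v (restrict_ffun (~: S) f) <=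
  (\sum_f u f) * (\sum_f v f).
Proof.
move=> u0 v0; rewrite big_distrlr/= pair_big/=.
pose h (f : {ffun 'I_m -> 'I_n}) := (restrict_ffun S f, restrict_ffun (~: S) f).
apply: (@sum_inj_le _ _ h (fun p => u p.1 * v p.2)) => [f1 f2|p]; last first.
  by rewrite mulr_ge0.
move=> [/ffunP e1 /ffunP e2]; apply/ffunP => k.
have [kS|kS] := boolP (k \in S).
  by have := e1 (enum_rank_in kS k); rewrite !ffunE enum_rankK_in.
rewrite -finset.in_setC in kS.
by have := e2 (enum_rank_in kS k); rewrite !ffunE enum_rankK_in.
Qed.

Variables (n : nat) (Z : 'I_n -> T -> R) (g theta : R) (Q : nat) (al : nat -> R) (W : R).
Let ex (j : nat) : R := j%:R * ((2 + g) / 2).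
Hypothesis g0 : 0 < g.
Hypothesis theta0 : 0 < theta.
Hypothesis mZ : forall i, measurable_fun setT (Z i).
Hypothesis EZ0 : forall i, Ex P (Z i) = 0.
Hypothesis iZ : forall i j, (2 <= j <= Q)%N -> intble P (fun w => `|Z i w| `^ ex j).
Hypothesis EZ : forall i j, (2 <= j <= Q)%N ->
  Ex P (fun w => `|Z i w| `^ ex j) <= theta `^ (2 + g).
Hypothesis al01 : forall r, 0 <= al r <= 1.

Definition past (c : nat) : set (set T) :=
  \bigcup_(i in [set i : 'I_n | (i <= c)%N]) preimage_set_system setT (Z i) measurable.
Definition future (c : nat) : set (set T) :=
  \bigcup_(i in [set i : 'I_n | (c <= i)%N]) preimage_set_system setT (Z i) measurable.

Hypothesis mix : forall (c : 'I_n) r A B, (0 < r)%N -> (c + r < n)%N ->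
  <<s past c >> A -> <<s future (c + r) >> B ->
  `|fine (P (A `&` B)) - fine (P A) * fine (P B)| <= al r.

Hypothesis W0 : 0 <= W.
Hypothesis al_sum :
  \sum_(1 <= r < n) r%:R ^+ (Q - 2) * al r `^ (g / (2 + g)) <= W.

(** At gap 0 the mixing rate is replaced by the trivial bound 1. *)
Definition gap_weight (r : nat) : R := if r is 0 then 1 else al r `^ (g / (2 + g)).

Definition mixed_moment (m : nat) (S : {set 'I_m}) (f : {ffun 'I_m -> 'I_n}) : R :=
  Ex P (fun w => \prod_(k in S) Z (f k) w).

Definition mixed_moment_sum (m : nat) : R :=
  \sum_(f : {ffun 'I_m -> 'I_n}) `|Ex P (fun w => \prod_k Z (f k) w)|.

Lemma mixed_moment_sum_ge0 m : 0 <= mixed_moment_sum m.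
Proof. exact: sumr_ge0. Qed.

Lemma mixed_moment_restrict m (S : {set 'I_m}) f :
  mixed_moment S f = Ex P (fun w => \prod_k Z (restrict_ffun S f k) w).
Proof.
rewrite /mixed_moment; congr Ex; apply/funext => w.
by rewrite big_enum_val/=; apply: eq_bigr => k _; rewrite ffunE.
Qed.

Lemma sum_mixed_moment_split m (S : {set 'I_m}) :
  \sum_f `|mixed_moment S f| * `|mixed_moment (~: S) f| <=
  mixed_moment_sum #|S| * mixed_moment_sum #|~: S|.
Proof.
rewrite /mixed_moment_sum.
under eq_bigr do rewrite !mixed_moment_restrict.
apply: (@sum_restrict_le m n S
  (fun f => `|Ex P (fun w => \prod_k Z (f k) w)|)
  (fun f => `|Ex P (fun w => \prod_k Z (f k) w)|)) => f; exact: normr_ge0.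
Qed.

Let cov_const_ge0 m : 0 <= cov_const m :> R.
Proof. by rewrite /cov_const; have : 0 <= m%:R :> R := ler0n _ _; nra. Qed.

Let gap_weight_ge0 r : 0 <= gap_weight r.
Proof. by case: r => [|r]//=; rewrite powR_ge0. Qed.

Let theta2_ge0 : 0 <= theta ^+ 2.
Proof. by rewrite exprn_ge0// ltW. Qed.

(** The blocks of the factorization are summed over all proper subsets S, so
    that the bound does not name the cut of f; likewise the covariance term is
    summed over all gaps r and all places (i, j) of the gap. *)
Lemma mixed_moment_gap m (f : {ffun 'I_m -> 'I_n}) : (2 <= m <= Q)%N ->
  `|Ex P (fun w => \prod_k Z (f k) w)| <=
  \sum_(S : {set 'I_m} | (S != finset.set0) && (S != [set: 'I_m]%SET))
     `|mixed_moment S f| * `|mixed_moment (~: S) f|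
  + \sum_(r < n) \sum_(p : 'I_m * 'I_m | p.1 != p.2)
     (gap_pattern r p.1 p.2 f)%:R * (cov_const m * (gap_weight r * theta ^+ 2)).
Proof.
move=> mQ; have m0 : (0 < m)%N by case/andP: mQ; case: (m).
pose Zf k := Z (f k).
have mZf k : measurable_fun setT (Zf k) by exact: mZ.
have iZf k : intble P (fun w => `|Zf k w| `^ ex m) by exact: iZ.
have EZf k : Ex P (fun w => `|Zf k w| `^ ex m) <= theta `^ (2 + g) by exact: EZ.
have term0 r p : 0 <= (gap_pattern r p.1 p.2 f)%:R *
    (cov_const m * (gap_weight r * theta ^+ 2)).
  by rewrite mulr_ge0 ?ler0n// mulr_ge0// mulr_ge0.
have pick_term (r : 'I_n) (i j : 'I_m) : i != j -> gap_pattern r i j f ->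
   cov_const m * (gap_weight r * theta ^+ 2) <=
   \sum_(r < n) \sum_(p : 'I_m * 'I_m | p.1 != p.2)
     (gap_pattern r p.1 p.2 f)%:R * (cov_const m * (gap_weight r * theta ^+ 2)).
  move=> ij gij; rewrite (bigD1 r)//= (bigD1 (i, j))//= gij mul1r -addrA lerDl.
  by rewrite addr_ge0// sumr_ge0// => r' _; rewrite sumr_ge0.
have [eqf|[i [j [fij cut bnd]]]] := largest_gap (fun k => nat_of_ord (f k)).
  (* f is constant: gap 0, between any two indices *)
  have mge2 : (1 < m)%N by case/andP: mQ.
  pose i := Ordinal m0; pose j := Ordinal mge2.
  have n0 : (0 < n)%N by case: (f i) => x; case: (n).
  apply: ler_wpDl; first by apply: sumr_ge0 => S _; rewrite mulr_ge0.
  apply: le_trans (pick_term (Ordinal n0) i j _ _) => //.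
    by rewrite /= mul1r; exact: (@Ex_prod_le _ _ _ P m g theta Zf).
  by rewrite /gap_pattern/= muln0 !addn0 (eqf j i) eqxx; apply/forallP => k;
    rewrite !addn0 (eqf k i) leqnn.
(* the cut: S holds the factors before the gap *)
set r := (f j - f i)%N in bnd.
have r0 : (0 < r)%N by rewrite subn_gt0.
have fjE : f j = (f i + r)%N :> nat by rewrite subnKC// ltnW.
have rn : (r < n)%N by rewrite (leq_ltn_trans (leq_subr _ _)).
pose S := [set k | (f k <= f i)%N]%SET.
have iS : i \in S by rewrite inE.
have jS : j \notin S by rewrite inE -ltnNge.
rewrite -[X in `|X|](subrK (mixed_moment S f * mixed_moment (~: S) f)).
rewrite addrC (le_trans (ler_normD _ _))// lerD//.
  rewrite (bigD1 S)/=; last first.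
    apply/andP; split; first by apply/set0Pn; exists i.
    by apply/eqP => ST; move: jS; rewrite ST inE.
  by rewrite normrM lerDl; apply: sumr_ge0 => S' _; rewrite mulr_ge0.
have Gm (G : set (set T)) (k : 'I_m) : (preimage_set_system setT (Z (f k)) measurable `<=` G) ->
    measurable_fun (setT : set (g_sigma_algebraType G)) (Zf k).
  move=> sG _ Y mY; rewrite setTI; apply: sub_sigma_algebra; apply: sG.
  by exists Y => //; rewrite setTI.
apply: (@le_trans _ _ (cov_const m * (al r `^ (g / (2 + g)) * theta ^+ 2))).
  apply: (@cov_prod _ _ _ P m g theta Zf m0 g0 theta0 mZf iZf EZf (past (f i))
    (future (f i + r)) S) => [k|k| |A B GA GB].
  - rewrite inE => kS; apply: Gm => A ZA; exists (f k) => //.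
  - rewrite inE -ltnNge => kS; apply: Gm => A ZA; exists (f k) => //=.
    by rewrite -fjE; have := cut k; rewrite leqNgt kS.
  - exact: al01.
  - by apply: mix GA GB => //; rewrite -fjE.
have -> : al r `^ (g / (2 + g)) = gap_weight (Ordinal rn).
  by rewrite /=; case: (r) r0.
apply: (pick_term (Ordinal rn) i j).
  by apply: contraTneq fij => ->; rewrite ltnn.
rewrite /gap_pattern/= fjE eqxx/=; apply/forallP => k.
by have := bnd k i; have := bnd i k; rewrite card_ord => -> ->.
Qed.

Definition moment_rec_const : R :=
  Q%:R ^+ 2 * (3 * Q%:R) ^+ (Q - 2) * cov_const Q * (1 + W).

(** The number of maps with gap r is of order [n * r^(m-2)], and [m <= Q]:
    this is where the weights [r^(Q-2)] of the mixing condition are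
    needed. *)
Lemma sum_gap_pattern m : (2 <= m <= Q)%N -> (0 < n)%N ->
  \sum_(f : {ffun 'I_m -> 'I_n}) \sum_(r < n) \sum_(p : 'I_m * 'I_m | p.1 != p.2)
     (gap_pattern r p.1 p.2 f)%:R * (cov_const m * (gap_weight r * theta ^+ 2))
  <= moment_rec_const * (n%:R * theta ^+ 2).
Proof.
move=> /andP[m2 mQ] n0.
pose b' (r : nat) : R := if r is 0 then 1 else r%:R ^+ (Q - 2) * al r `^ (g / (2 + g)).
have Q1 : (1 <= 3 * Q%:R :> R) by rewrite -natrM ler1n; lia.
have term (r : nat) : ((2 * m * r + 1) ^ (m - 2))%N%:R * gap_weight r <=
    (3 * Q%:R) ^+ (Q - 2) * b' r.
  case: r => [|r]; first by rewrite muln0 add0n exp1n !mulr1 exprn_ege1.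
  rewrite /b' /= mulrA ler_wpM2r ?powR_ge0// -exprMn.
  rewrite natrX; apply: (@le_trans _ _ ((3 * Q%:R * r.+1%:R) ^+ (m - 2))).
    apply: lerXn2r; rewrite ?nnegrE ?ler0n ?mulr_ge0//.
    by rewrite -!natrM ler_nat; nia.
  by apply: ler_weXn2l; [rewrite -!natrM ler1n; lia|lia].
have sumb' : \sum_(r < n) b' r <= 1 + W.
  rewrite -(big_mkord xpredT b') big_ltn// lerD2l.
  apply: le_trans al_sum; rewrite le_eqVlt; apply/orP; left; apply/eqP.
  by apply: eq_big_nat => -[|r].
rewrite exchange_big/=.
apply: (@le_trans _ _ (\sum_(r < n) m%:R ^+ 2 * (n%:R *
   ((2 * m * r + 1) ^ (m - 2))%N%:R * (cov_const m * (gap_weight r * theta ^+ 2))))).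
  apply: ler_sum => r _; rewrite exchange_big/=.
  apply: (@le_trans _ _ (\sum_(p : 'I_m * 'I_m) n%:R *
   ((2 * m * r + 1) ^ (m - 2))%N%:R * (cov_const m * (gap_weight r * theta ^+ 2)))).
    rewrite big_mkcond/=; apply: ler_sum => -[i j] _/=.
    case: ifPn => [ij|_]; last by repeat apply: mulr_ge0 => //.
    rewrite -mulr_suml; apply: ler_wpM2r; first by repeat apply: mulr_ge0 => //.
    rewrite -natr_sum -natrM ler_nat.
    apply: leq_trans (card_gap_pattern n r ij).
    by rewrite -sum1_card [leqRHS]big_mkcond/=; apply: leq_sum => f _; rewrite inE; case: ifP.
  by rewrite sumr_const card_prod !card_ord -[leLHS]mulr_natl natrM expr2.
apply: (@le_trans _ _ (\sum_(r < n) m%:R ^+ 2 * (n%:R * cov_const m * theta ^+ 2) *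
   ((3 * Q%:R) ^+ (Q - 2) * b' r))).
  apply: ler_sum => r _.
  rewrite [leLHS](_ : _ = m%:R ^+ 2 * (n%:R * cov_const m * theta ^+ 2) *
    (((2 * m * r + 1) ^ (m - 2))%N%:R * gap_weight r)); last by ring.
  by apply: ler_wpM2l; [nneg|exact: term].
rewrite -mulr_sumr -mulr_sumr /moment_rec_const.
rewrite [leLHS](_ : _ = (m%:R ^+ 2 * (3 * Q%:R) ^+ (Q - 2) * cov_const m *
   \sum_(r < n) b' r) * (n%:R * theta ^+ 2)); last by ring.
apply: ler_wpM2r; first by nneg.
apply: ler_pM => //; first by nneg.
  by apply: sumr_ge0 => -[[|r] rn] _ //=; nneg.
have mQ' : m%:R <= Q%:R :> R by rewrite ler_nat.
have mm : m%:R ^+ 2 <= Q%:R ^+ 2 :> R by apply: lerXn2r => //; rewrite nnegrE.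
apply: ler_pM => //; first by apply: ler_wpM2r => //; nneg.
by rewrite /cov_const lerD2r lerD// ler_wpM2l.
Qed.

Fixpoint moment_const (m : nat) : R :=
  if m is m'.+1 then 2 ^+ m * moment_const m' ^+ 2 + moment_rec_const else 1.

Lemma moment_rec_const_ge0 : 0 <= moment_rec_const.
Proof.
by rewrite /moment_rec_const; nneg.
Qed.

Lemma moment_const_ge1 m : 1 <= moment_const m.
Proof.
elim: m => [|m IH]//=; apply: ler_wpDr; first exact: moment_rec_const_ge0.
by rewrite -[leLHS]mul1r ler_pM// ?exprn_ege1 ?ler1n.
Qed.

Lemma moment_const_leS m : moment_const m <= moment_const m.+1.
Proof.
rewrite /=; apply: ler_wpDr; first exact: moment_rec_const_ge0.
have := moment_const_ge1 m => h.
rewrite expr2 mulrA -[leLHS]mul1r ler_pM ?(le_trans ler01 h)//.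
by rewrite -[leLHS]mul1r ler_pM// ?exprn_ege1 ?ler1n.
Qed.

Hypothesis ntheta : 1 <= n%:R * theta ^+ 2.
Let y : R := Num.sqrt n%:R * theta.

Let y2 : y ^+ 2 = n%:R * theta ^+ 2.
Proof. by rewrite /y exprMn sqr_sqrtr. Qed.

Let y_ge1 : 1 <= y.
Proof.
have y0 : 0 <= y by rewrite mulr_ge0 ?sqrtr_ge0 ?ltW.
by rewrite -(@ler_pXn2r _ 2)// ?nnegrE// expr1n y2.
Qed.

(** Centring makes the sum vanish for one factor.  In the induction step the
    blocks contribute [y^#|S| * y^#|~: S|], and the covariances a multiple of
    [y^2], which is at most [y^l] because [y >= 1]. *)
Lemma mixed_moment_sum_le m l : (0 < l <= m)%N -> (l <= Q)%N ->
  mixed_moment_sum l <= moment_const m * y ^+ l.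
Proof.
have y0 : 0 <= y by rewrite (le_trans _ y_ge1).
have n0 : (0 < n)%N.
  by case: (n) ntheta => //; rewrite mul0r => /(lt_le_trans ltr01); rewrite ltxx.
elim: m l => [|m IH] l; first by case: l.
move=> /andP[l0 lm] lQ; have [lm'|ml] := leqP l m.
  rewrite (le_trans (IH l _ lQ)) ?l0// ler_wpM2r ?exprn_ge0//.
  exact: moment_const_leS.
have e : l = m.+1 by apply/eqP; rewrite eqn_leq lm.
subst l; move: m IH lQ {l0 lm ml} => [|m] IH lQ.
  rewrite /mixed_moment_sum big1.
    by apply: mulr_ge0; [exact: le_trans (moment_const_ge1 _)|exact: exprn_ge0].
  move=> f _; rewrite (_ : (fun w => _) = Z (f ord0)) ?EZ0 ?normr0//.
  by apply/funext => w; rewrite big_ord1.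
have mQ : (2 <= m.+2 <= Q)%N by rewrite lQ.
rewrite /mixed_moment_sum.
apply: (le_trans (ler_sum _ (fun f _ => mixed_moment_gap f mQ))).
rewrite big_split/= mulrDl lerD//; last first.
  apply: (le_trans (sum_gap_pattern mQ n0)).
  rewrite ler_wpM2l ?moment_rec_const_ge0// -y2.
  exact: ler_weXn2l.
rewrite exchange_big/=.
apply: (@le_trans _ _ (\sum_(S : {set 'I_m.+2})
    moment_const m.+1 ^+ 2 * y ^+ m.+2)); last first.
  rewrite sumr_const -[leLHS]mulr_natl -cardsT -powersetT card_powerset cardsT card_ord.
  by rewrite natrX mulrA.
rewrite big_mkcond/=; apply: ler_sum => S _; case: ifPn => [/andP[S0 ST]|_]; last first.
  by apply: mulr_ge0; [exact: sqr_ge0|exact: exprn_ge0].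
apply: (le_trans (sum_mixed_moment_split S)).
have SC : (#|S| + #|~: S| = m.+2)%N by rewrite cardsC card_ord.
have cS : (0 < #|S|)%N by rewrite card_gt0.
have cSC : (0 < #|~: S|)%N.
  by rewrite card_gt0; apply: contraNneq ST => e; rewrite -[S]finset.setCK e finset.setC0.
have cSm : (#|S| <= m.+1)%N by apply: leq_of_addnS SC cSC.
have cSCm : (#|~: S| <= m.+1)%N.
  by apply: (leq_of_addnS (b := #|S|)) => //; rewrite addnC.
rewrite -[X in y ^+ X]SC exprD [X in _ <= X * _]expr2 mulrACA ler_pM ?mixed_moment_sum_ge0//.
  by apply: IH; rewrite ?cS/= ?(leq_trans cSm)// ltnW.
by apply: IH; rewrite ?cSC/= ?(leq_trans cSCm)// ltnW.
Qed.

(** The power of the sum is the sum of the products over all index maps. *)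
Lemma Ex_sum_pow_le : (2 <= Q)%N ->
  intble P (fun w => (\sum_i Z i w) ^+ Q) /\
  Ex P (fun w => (\sum_i Z i w) ^+ Q) <= moment_const Q * y ^+ Q.
Proof.
move=> Q2; have Q0 : (0 < Q)%N by rewrite (leq_trans _ Q2).
have -> : (fun w => (\sum_i Z i w) ^+ Q) =
    fun w => \sum_(f : {ffun 'I_Q -> 'I_n}) \prod_k Z (f k) w.
  apply/funext => w; rewrite -(bigA_distr_bigA (fun (k : 'I_Q) i => Z i w)).
  by rewrite prodr_const card_ord.
have iprod (f : {ffun 'I_Q -> 'I_n}) : intble P (fun w => \prod_k Z (f k) w).
  rewrite (_ : (fun w => _) = fun w => \prod_(k in [set: 'I_Q]%SET) Z (f k) w).
    apply: (@intble_prod _ _ _ P Q g theta (fun k => Z (f k))) => // k.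
    by apply: iZ; rewrite Q2 leqnn.
  by apply/funext => w; apply: eq_bigl => k; rewrite finset.in_setT.
split; first by apply: intble_sum => f _; exact: iprod.
rewrite Ex_sum//; apply: (@le_trans _ _ (mixed_moment_sum Q)).
  by apply: ler_sum => f _; exact: ler_norm.
by apply: mixed_moment_sum_le; rewrite ?Q0 leqnn.
Qed.

End mixed_moments.

(** * Norms in L^Q *)

Section Lnorm_bounds.
Context {R : realType} {d : measure_display} {T : measurableType d}.
Variables (P : probability T R) (Q : nat).
Hypothesis Q0 : (0 < Q)%N.

Definition Lnorm_le (f : T -> R) (c : R) :=
  measurable_fun setT f /\ ('N[P]_(Q%:R%:E)[EFin \o f] <= c%:E)%E.

Let Qn0 : Q%:R != 0 :> R. Proof. by rewrite pnatr_eq0 -lt0n. Qed.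

Let power_abs f :
  (\int[P]_w (`|(EFin \o f) w| `^ Q%:R) = \int[P]_w (`|f w| ^+ Q)%:E)%E.
Proof.
by apply: eq_integral => w _ /=; rewrite powR_mulrn.
Qed.

Lemma Lnorm_leP (f : T -> R) c : 0 <= c ->
  ('N[P]_(Q%:R%:E)[EFin \o f] <= c%:E)%E <->
  (\int[P]_w (`|f w| ^+ Q)%:E <= (c ^+ Q)%:E)%E.
Proof.
move=> c0; have i0 : (0 <= \int[P]_w (`|f w| ^+ Q)%:E)%E.
  by apply: integral_ge0 => w _; rewrite lee_fin exprn_ge0.
split=> h.
  rewrite -power_abs -poweR_Lnorm// -powR_mulrn// -poweR_EFin.
  by rewrite gt0_ler_poweR// in_itv/= leey ?andbT ?Lnorm_ge0// lee_fin.
have -> : c%:E = ((c ^+ Q)%:E `^ (Q%:R)^-1)%E.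
  by rewrite -powR_mulrn// poweR_EFin -powRrM mulfV// powRr1.
rewrite unlock power_abs; apply: gt0_ler_poweR h; rewrite ?invr_ge0 ?ler0n//.
  by rewrite in_itv/= leey i0.
by rewrite in_itv/= leey lee_fin exprn_ge0.
Qed.

Lemma Lnorm_le_trans f c c' : c <= c' -> Lnorm_le f c -> Lnorm_le f c'.
Proof. by move=> cc' [mf h]; split => //; rewrite (le_trans h)// lee_fin. Qed.

Lemma Lnorm_le_add f g c c' : Lnorm_le f c -> Lnorm_le g c' ->
  Lnorm_le (fun w => f w + g w) (c + c').
Proof.
move=> [mf hf] [mg hg]; split; first exact: measurable_funD.
have -> : EFin \o (fun w => f w + g w) = EFin \o (f \+ g)%R by [].
rewrite (le_trans (minkowski_EFin _ mf mg _))//; first by rewrite ler1n.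
by rewrite EFinD leeD.
Qed.

Lemma Lnorm_le_cst c : 0 <= c -> Lnorm_le (fun=> c) c.
Proof.
move=> c0; split=> //; apply/Lnorm_leP => //.
by rewrite ger0_norm// integral_cst// [X in (_ * X)%E](probability_setT P) mule1.
Qed.

Lemma Lnorm_le_Ex (f : T -> R) c : measurable_fun setT f -> 0 <= c ->
  intble P (fun w => `|f w| ^+ Q) -> Ex P (fun w => `|f w| ^+ Q) <= c ^+ Q ->
  Lnorm_le f c.
Proof.
move=> mf c0 fi fc; split=> //; apply/Lnorm_leP => //.
rewrite -[leLHS]fineK; last exact: integrable_fin_num.
by rewrite lee_fin.
Qed.

(** The maximum is dominated by the Q-th root of the sum of the Q-th powers,
    which is measurable and has an explicit norm. *)
Lemma Lnorm_le_max (I : finType) (f : I -> T -> R) (c : R) : 0 <= c ->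
  (forall i, Lnorm_le (f i) c) ->
  exists W, [/\ forall w, 0 <= W w, forall i w, `|f i w| <= W w &
    Lnorm_le W (#|I|%:R `^ Q%:R^-1 * c)].
Proof.
move=> c0 fc.
pose W w := (\sum_i `|f i w| ^+ Q) `^ Q%:R^-1.
have S0 w : 0 <= \sum_i `|f i w| ^+ Q by apply: sumr_ge0 => i _; exact: exprn_ge0.
have WQ w : W w ^+ Q = \sum_i `|f i w| ^+ Q.
  by rewrite -powR_mulrn ?powR_ge0// -powRrM mulVf// powRr1.
exists W; split=> [w|i w|]; first exact: powR_ge0.
  rewrite -(@ler_pXn2r _ Q)// ?nnegrE ?powR_ge0// WQ (bigD1 i)//=.
  by rewrite lerDl sumr_ge0// => j _; exact: exprn_ge0.
have mfi i : measurable_fun setT (fun w => `|f i w| ^+ Q).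
  by apply: measurable_funX; apply: measurableT_comp => //; case: (fc i).
split.
  apply: (@measurableT_comp _ _ _ _ _ _ (fun x : R => x `^ Q%:R^-1)).
    exact: measurable_powR.
  exact: measurable_sum.
apply/Lnorm_leP; first by rewrite mulr_ge0 ?powR_ge0.
have -> : (\int[P]_w (`|W w| ^+ Q)%:E = \int[P]_w \sum_i (`|f i w| ^+ Q)%:E)%E.
  by apply: eq_integral => w _; rewrite ger0_norm ?powR_ge0// WQ sumEFin.
rewrite ge0_integral_sum//; last first.
  by move=> i; exact/measurable_EFinP.
rewrite exprMn -[X in X * _]powR_mulrn ?powR_ge0// -powRrM mulVf// powRr1//.
apply: (@le_trans _ _ (\sum_(i : I) (c ^+ Q)%:E)%E).
  by apply: lee_sum => i _; apply/Lnorm_leP => //; case: (fc i).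
by rewrite sumEFin sumr_const mulr_natl.
Qed.

End Lnorm_bounds.

(** * Moments of centred variables *)

Section centering.
Context {R : realType} {d : measure_display} {T : measurableType d}.
Variables (P : probability T R) (f : T -> R) (s B : R).
Hypothesis s1 : 1 <= s.
Hypothesis B0 : 0 < B.
Hypothesis mf : measurable_fun setT f.
Hypothesis fi : intble P (fun w => `|f w| `^ s).
Hypothesis fB : Ex P (fun w => `|f w| `^ s) <= B.

Let M := B `^ s^-1.
Let s0 : 0 < s. Proof. exact: lt_le_trans s1. Qed.
Let M0 : 0 < M. Proof. exact: powR_gt0. Qed.
Let Ms : M `^ s = B.
Proof. by rewrite /M -powRrM mulVf ?gt_eqF// powRr1// ltW. Qed.

Let dom w : `|f w| <= M + M / B * `|f w| `^ s.
Proof.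
have [fM|Mf] := leP `|f w| M.
  by rewrite (le_trans fM)// lerDl; apply: mulr_ge0; rewrite ?powR_ge0 ?divr_ge0 ?ltW.
apply: ler_wpDl; first exact: ltW.
have f0 : 0 < `|f w| by exact: lt_trans Mf.
have -> : M / B = M `^ (1 - s).
  by rewrite powRB ?(lt0r_neq0 M0) ?implybT// powRr1 ?(ltW M0)// Ms.
rewrite [leLHS](_ : _ = `|f w| `^ (1 - s) * `|f w| `^ s); last first.
  by rewrite -powRD ?(lt0r_neq0 f0) ?implybT// subrK powRr1.
rewrite ler_wpM2r ?powR_ge0// -[1 - s]opprB !powRN lef_pV2 ?posrE ?powR_gt0//.
by apply: ge0_ler_powR; rewrite ?nnegrE ?subr_ge0 ?(ltW M0)// ltW.
Qed.

Let idom : intble P (fun w => M + M / B * `|f w| `^ s).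
Proof. by apply: intbleD; [exact: intble_cst|exact: intbleZ]. Qed.

Lemma intble_powR : intble P f.
Proof. exact: intble_le mf dom idom. Qed.

(** A weak form of Jensen's inequality, from the bound of |f| by [M + M / B *
    |f|^s] with [M^s = B]: it costs the factor [2^s], which is harmless
    here. *)
Lemma Ex_abs_powR : `|Ex P f| `^ s <= 2 `^ s * B.
Proof.
rewrite -Ms -powRM// ?(ltW M0)//.
apply: ge0_ler_powR; rewrite ?nnegrE ?mulr_ge0 ?(ltW M0) ?(ltW s0)//.
rewrite (le_trans (Ex_norm_le mf idom dom))//.
rewrite ExD ?ExZ ?Ex_cst//; [|exact: intble_cst|exact: intbleZ].
rewrite mulr2n mulrDl mul1r lerD2l -[leRHS](divfK (lt0r_neq0 B0)).
by rewrite ler_wpM2l// divr_ge0 ?ltW.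
Qed.

Lemma centered_moment (c := Ex P f) :
  intble P (fun w => `|f w - c| `^ s) /\
  Ex P (fun w => `|f w - c| `^ s) <= 2 `^ s * (1 + 2 `^ s) * B.
Proof.
have pt w : `| `|f w - c| `^ s| <= 2 `^ s * (`|f w| `^ s + `|c| `^ s).
  rewrite ger0_norm ?powR_ge0//.
  apply: (@le_trans _ _ ((2 * Num.max `|f w| `|c|) `^ s)).
    apply: ge0_ler_powR; rewrite ?nnegrE ?mulr_ge0 ?le_max ?normr_ge0 ?(ltW s0)//.
    rewrite (le_trans (ler_normB _ _))// mulr2n mulrDl mul1r.
    by rewrite lerD// le_max lexx ?orbT.
  rewrite powRM ?le_max ?normr_ge0// ler_wpM2l ?powR_ge0//.
  by case: (leP `|f w| `|c|) => _; rewrite ?lerDl ?lerDr powR_ge0.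
have ig : intble P (fun w => 2 `^ s * (`|f w| `^ s + `|c| `^ s)).
  by apply: intbleZ; apply: intbleD => //; exact: intble_cst.
have mg : measurable_fun setT (fun w => `|f w - c| `^ s).
  apply: (@measurableT_comp _ _ _ _ _ _ (fun x : R => x `^ s)).
    exact: measurable_powR.
  by apply: measurableT_comp => //; exact: measurable_funB.
split; first exact: intble_le mg pt ig.
rewrite (le_trans (ler_norm _))// (le_trans (Ex_norm_le mg ig pt))//.
rewrite ExZ; last by apply: intbleD => //; exact: intble_cst.
rewrite ExD//; last exact: intble_cst.
rewrite Ex_cst -mulrA ler_wpM2l ?powR_ge0// mulrDl mul1r lerD//.
exact: Ex_abs_powR.
Qed.

End centering.

(** * Mixing rates of a triangular array *)

Section array.
Context {R : realType} {dO dS : measure_display}.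
Context {Omega : measurableType dO} {S : measurableType dS}.
Variables (P : probability Omega R) (X : nat -> nat -> Omega -> S).
Hypothesis X_meas : forall n t, (1 <= t <= n)%N -> measurable_fun setT (X n t).

Lemma array_sigma_measurable n i k : (1 <= i)%N -> (k <= n)%N ->
  array_sigma X n i k `<=` measurable.
Proof.
move=> i1 kn; apply: smallest_sub; first exact: sigma_algebra_measurable.
move=> A [j /= /andP[ij jk]] [Y mY <-]; apply: X_meas => //.
by rewrite (leq_trans i1 ij) (leq_trans jk kn).
Qed.

Lemma prob_cov_fine A B : measurable A -> measurable B ->
  (`|P (A `&` B) - P A * P B| = `|fine (P (A `&` B)) - fine (P A) * fine (P B)|%:E)%E.
Proof.
move=> mA mB; rewrite -[in LHS](fineK (fin_num_measure P _ (measurableI _ _ mA mB))).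
by rewrite -[in LHS](fineK (fin_num_measure P _ mA)) -[in LHS](fineK (fin_num_measure P _ mB)).
Qed.

Lemma alpha_row01 n t : (0 <= alpha_row P X n t <= 1)%E.
Proof.
rewrite /alpha_row; case: ifPn => [tn|_]; last by rewrite lexx lee01.
have row_le1 : (ereal_sup [set a | exists k A B,
      [/\ (1 <= k <= n - t)%N, array_sigma X n 1 k A, array_sigma X n (k + t) n B &
          a = `|P (A `&` B) - P A * P B|] ] <= 1)%E.
  apply: ge_ereal_sup => _ [k [A [B [/andP[k1 kn] sA sB ->]]]].
  have mA : measurable A.
    by apply: array_sigma_measurable sA => //; rewrite (leq_trans kn)// leq_subr.
  have mB : measurable B.
    by apply: array_sigma_measurable sB => //; rewrite (leq_trans k1)// leq_addr.
  rewrite prob_cov_fine// lee_fin.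
  have pr01 C : measurable C -> 0 <= fine (P C) <= 1.
    move=> mC; rewrite -!lee_fin fineK ?fin_num_measure// measure_ge0.
    exact: probability_le1.
  have /andP[a0 a1] := pr01 _ mA; have /andP[b0 b1] := pr01 _ mB.
  have /andP[c0 c1] := pr01 _ (measurableI _ _ mA mB).
  by rewrite ler_norml; apply/andP; split; nra.
rewrite row_le1 andbT; apply: ereal_sup_ubound.
exists 1%N, set0, set0; split.
- by rewrite subn_gt0.
- exact: sigma_algebra0.
- exact: sigma_algebra0.
- by rewrite set0I !measure0 mule0 sube0 abse0.
Qed.

Lemma alpha_mixing01 t : (0 <= alpha_mixing P X t <= 1)%E.
Proof.
case: t => [|t]; first by rewrite /= lee01 lexx.
rewrite /alpha_mixing; apply/andP; split.
  apply: (@le_trans _ _ (alpha_row P X 0 t.+1)).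
    by have /andP[] := alpha_row01 0 t.+1.
  by apply: ereal_sup_ubound; exists 0%N.
by apply: ge_ereal_sup => _ [n _ <-]; have /andP[] := alpha_row01 n t.+1.
Qed.

(** The mixing coefficient is at most 1, hence a real number. *)
Definition mix_rate t : R := fine (alpha_mixing P X t).

Lemma mix_rateE t : alpha_mixing P X t = (mix_rate t)%:E.
Proof.
have /andP[a0 a1] := alpha_mixing01 t.
by rewrite /mix_rate fineK// ge0_fin_numE// (le_lt_trans a1)// ltry.
Qed.

Lemma mix_rate01 t : 0 <= mix_rate t <= 1.
Proof. by rewrite -!lee_fin -mix_rateE; exact: alpha_mixing01. Qed.

Lemma mix_rate_le n c r A B : (1 <= c)%N -> (c + r <= n)%N -> (0 < r)%N ->
  array_sigma X n 1 c A -> array_sigma X n (c + r) n B ->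
  `|fine (P (A `&` B)) - fine (P A) * fine (P B)| <= mix_rate r.
Proof.
move=> c1 crn r0 sA sB.
have mA : measurable A.
  by apply: array_sigma_measurable sA => //; rewrite (leq_trans _ crn)// leq_addr.
have mB : measurable B.
  by apply: array_sigma_measurable sB => //; rewrite (leq_trans c1)// leq_addr.
rewrite -lee_fin -prob_cov_fine// -mix_rateE.
case: r r0 crn sB => // r _ crn sB.
apply: (@le_trans _ _ (alpha_row P X n r.+1)); last first.
  by apply: ereal_sup_ubound; exists n.
have rn : (r.+1 < n)%N by rewrite (leq_trans _ crn)// -[ltnLHS]add0n ltn_add2r.
rewrite /alpha_row rn; apply: ereal_sup_ubound; exists c, A, B; split => //.
by rewrite c1/= leq_subRL// ?(ltnW rn)// addnC.
Qed.

Variables (g : R) (Q : nat).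
Hypothesis g0 : 0 < g.

Lemma mix_rate_sum :
  (\sum_(1 <= t <oo)
     (t%:R ^+ (Q - 2))%:E * alpha_mixing P X t `^ (g / (2 + g))%R < +oo)%E ->
  exists2 W : R, 0 <= W & forall n,
    \sum_(1 <= r < n) r%:R ^+ (Q - 2) * mix_rate r `^ (g / (2 + g)) <= W.
Proof.
under eq_eseriesr do rewrite mix_rateE poweR_EFin -EFinM.
set u := fun t : nat => t%:R ^+ (Q - 2) * mix_rate t `^ (g / (2 + g)).
have u0 t : 0 <= u t by rewrite mulr_ge0 ?powR_ge0 ?exprn_ge0.
move=> fin; have s0 : (0 <= \sum_(1 <= t <oo) (u t)%:E)%E.
  by apply: nneseries_ge0 => t _ _; rewrite lee_fin.
exists (fine (\sum_(1 <= t <oo) (u t)%:E)%E); first exact: fine_ge0.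
move=> n; rewrite -lee_fin fineK; last by rewrite ge0_fin_numE.
rewrite -sumEFin; by apply: nneseries_lim_ge => t _ _; rewrite lee_fin; exact: u0.
Qed.

End array.

(** * Moments of the empirical process *)

Section empirical_moment.
Context {R : realType} {dO dS : measure_display}.
Context {Omega : measurableType dO} {S : measurableType dS}.
Variables (P : probability Omega R) (X : nat -> nat -> Omega -> S).
Hypothesis X_meas : forall n t, (1 <= t <= n)%N -> measurable_fun setT (X n t).
Variables (g : R) (Q : nat) (W : R).
Hypothesis g0 : 0 < g.
Hypothesis Q2 : (2 <= Q)%N.
Hypothesis Q_even : ~~ odd Q.
Hypothesis W0 : 0 <= W.
Hypothesis rate_sum : forall n,
  \sum_(1 <= r < n) r%:R ^+ (Q - 2) * mix_rate P X r `^ (g / (2 + g)) <= W.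

Definition moment_exp (j : nat) : R := j%:R * ((2 + g) / 2).

(** The size of h in row n: theta is calibrated so that the square of theta is
    the order of the covariances in [cov_prod]. *)
Definition row_moments (n : nat) (h : S -> R) (theta : R) :=
  measurable_fun setT h /\
  forall t j, (1 <= t <= n)%N -> (2 <= j <= Q)%N ->
    intble P (fun w => `|h (X n t w)| `^ moment_exp j) /\
    Ex P (fun w => `|h (X n t w)| `^ moment_exp j) <= theta `^ (2 + g).

Let K : R := 2 `^ moment_exp Q * (1 + 2 `^ moment_exp Q).
Let scale := K `^ (2 + g)^-1.

Definition empirical_const : R := moment_const Q W Q `^ Q%:R^-1 * scale.

Let g2 : 0 < 2 + g. Proof. by rewrite addr_gt0. Qed.

Let exp_ge1 j : (2 <= j)%N -> 1 <= moment_exp j.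
Proof.
move=> j2; have : 2 <= j%:R :> R by rewrite ler_nat.
rewrite /moment_exp => h; have := g0; nra.
Qed.

Let exp_le j : (j <= Q)%N -> moment_exp j <= moment_exp Q.
Proof.
by move=> jQ; rewrite /moment_exp ler_wpM2r ?ler_nat// divr_ge0// ltW.
Qed.

Let K1 : 1 <= K.
Proof.
have h : 1 <= 2 `^ moment_exp Q :> R.
  rewrite -[leLHS](powRr0 2); apply: ler_powR; first by rewrite ler1n.
  by rewrite (le_trans ler01)// exp_ge1.
by rewrite -[leLHS]mul1r ler_pM// ler_wpDr// (le_trans ler01).
Qed.

Let scale1 : 1 <= scale.
Proof.
rewrite /scale -[leLHS](powRr0 K); apply: ler_powR => //.
by rewrite invr_ge0 ltW.
Qed.

Lemma empirical_const_ge0 : 0 <= empirical_const.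
Proof. by apply: mulr_ge0; exact: powR_ge0. Qed.

Lemma empirical_process1E n h w : empirical_process P X n 1 h w =
  (Num.sqrt n%:R)^-1 * \sum_(i < n) (h (X n i.+1 w) - Ex P (h \o X n i.+1)).
Proof.
rewrite /empirical_process mulr1 natrK; congr (_ * _).
rewrite big_add1/= big_mkord; apply: eq_bigr => i _; congr (_ - _).
by rewrite unlock.
Qed.

(** Centring multiplies the moments by at most a constant, which [scale]
    absorbs into theta.  As Q is even, the moment of order Q is that of the
    absolute value. *)
Lemma Lnorm_le_empirical n h theta : (0 < n)%N -> 0 < theta ->
  1 <= n%:R * theta ^+ 2 -> row_moments n h theta ->
  Lnorm_le P Q (empirical_process P X n 1 h) (empirical_const * theta).
Proof.
move=> n0 theta0 ntheta [mh hm].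
have mhX t : (1 <= t <= n)%N -> measurable_fun setT (h \o X n t).
  by move=> tn; apply: measurableT_comp => //; exact: X_meas.
have it (i : 'I_n) : (1 <= i.+1 <= n)%N by rewrite ltn_ord.
pose c (i : 'I_n) := Ex P (h \o X n i.+1).
pose Z (i : 'I_n) w := h (X n i.+1 w) - c i.
have mZ i : measurable_fun setT (Z i).
  by apply: measurable_funB => //; exact: mhX.
have ihX (i : 'I_n) : intble P (h \o X n i.+1).
  have [ih _] := hm i.+1 2 (it i) Q2.
  apply: (intble_powR (s := moment_exp 2) (B := theta `^ (2 + g))) => //.
  - exact: exp_ge1.
  - exact: powR_gt0.
  - exact: mhX.
have EZ0 (i : 'I_n) : Ex P (Z i) = 0.
  transitivity (Ex P (h \o X n i.+1) - Ex P (fun=> c i)).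
    exact: (ExB (ihX i) (intble_cst P (c i))).
  by rewrite Ex_cst subrr.
pose theta' := scale * theta.
have theta'0 : 0 < theta' by rewrite mulr_gt0// (lt_le_trans ltr01).
have theta'E : theta' `^ (2 + g) = K * theta `^ (2 + g).
  rewrite /theta' powRM ?powR_ge0 ?(ltW theta0)// /scale -powRrM mulVf ?gt_eqF//.
  by rewrite powRr1// (le_trans ler01 K1).
have Zmom (i : 'I_n) j : (2 <= j <= Q)%N -> intble P (fun w => `|Z i w| `^ moment_exp j) /\
    Ex P (fun w => `|Z i w| `^ moment_exp j) <= theta' `^ (2 + g).
  move=> jQ; have [j2 jle] := andP jQ.
  have [ih Eh] := hm i.+1 j (it i) jQ.
  have [|||iZ EZ] := @centered_moment _ _ _ P (h \o X n i.+1) (moment_exp j)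
    (theta `^ (2 + g)) _ _ _ ih Eh.
  - exact: exp_ge1.
  - exact: powR_gt0.
  - exact: mhX.
  split => //; rewrite (le_trans EZ)// theta'E ler_wpM2r ?powR_ge0// /K.
  have le2 : 2 `^ moment_exp j <= 2 `^ moment_exp Q :> R.
    by apply: ler_powR; [rewrite ler1n|exact: exp_le].
  by rewrite ler_pM ?powR_ge0 ?addr_ge0 ?powR_ge0// lerD2l.
have sub_sigma (i k : nat) (G : set (set Omega)) :
    (forall A, G A -> exists2 j : 'I_n, (i <= j.+1 <= k)%N &
       preimage_set_system setT (Z j) measurable A) ->
    <<s G >> `<=` array_sigma X n i k.
  move=> sG; apply: sub_sigma_algebra2 => A /sG[j jk [Y mY <-]].
  exists j.+1 => //; exists ((fun x => h x - c j) @^-1` Y) => //.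
  rewrite -[X in measurable X]setTI.
  by apply: (measurable_funB mh (measurable_cst _)).
have [] := @Ex_sum_pow_le _ _ _ P n Z g theta' Q (mix_rate P X) W g0 theta'0 mZ EZ0
  (fun i j h => (Zmom i j h).1) (fun i j h => (Zmom i j h).2)
  (mix_rate01 P X_meas) _ W0 (rate_sum n) _ Q2.
- move=> k r A B r0 kr sA sB.
  apply: (mix_rate_le P X_meas (c := k.+1) (n := n)) => //.
    apply: sub_sigma sA => {}A [j /= jk ZA]; exists j => //.
  apply: sub_sigma sB => {}B [j /= jk ZB]; exists j => //.
  by rewrite addSn ltnS jk ltn_ord.
- rewrite (le_trans ntheta)// ler_wpM2l// lerXn2r ?nnegrE ?(ltW theta0) ?(ltW theta'0)//.
  by rewrite /theta' ler_peMl// ltW.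
set y := Num.sqrt n%:R * theta' => isum Esum.
have mc0 := moment_const_ge1 Q W0 Q.
have sn0 : 0 < Num.sqrt n%:R :> R by rewrite sqrtr_gt0 ltr0n.
have GE : empirical_process P X n 1 h = fun w => (Num.sqrt n%:R)^-1 * \sum_i Z i w.
  by apply/funext => w; rewrite empirical_process1E.
have Q0 : (0 < Q)%N by rewrite (leq_trans _ Q2).
have sumQ0 w : 0 <= (\sum_i Z i w) ^+ Q by apply: exprn_even_ge0.
have EG : (fun w => `|empirical_process P X n 1 h w| ^+ Q) =
   fun w => (Num.sqrt n%:R)^-1 ^+ Q * (\sum_i Z i w) ^+ Q.
  apply/funext => w; rewrite GE normrM exprMn ger0_norm ?invr_ge0 ?(ltW sn0)//.
  by rewrite -normrX ger0_norm.
apply: Lnorm_le_Ex => //.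
- rewrite GE; apply: measurable_funM => //; exact: measurable_sum.
- by apply: mulr_ge0; [exact: empirical_const_ge0|exact: ltW].
- by rewrite EG; exact: intbleZ.
rewrite EG ExZ//.
have -> : empirical_const * theta = moment_const Q W Q `^ Q%:R^-1 * theta'.
  by rewrite /empirical_const /theta' mulrA.
rewrite [leRHS]exprMn -[X in _ <= X * _]powR_mulrn ?powR_ge0// -powRrM mulVf; last first.
  by rewrite pnatr_eq0 -lt0n.
rewrite powRr1 ?(le_trans ler01)// exprVn ler_pdivrMl ?exprn_gt0//.
by rewrite mulrCA -exprMn.
Qed.

End empirical_moment.

(** * Moments of brackets and of close pairs *)

Section moments_from_norms.
Context {R : realType} {d : measure_display} {T : measurableType d}.
Variable P : probability T R.

Lemma expectation_poweR_le (f : T -> R) (r c : R) : 0 < r -> 0 <= c ->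
  measurable_fun setT f -> (forall w, 0 <= f w) ->
  ('E_P[f] `^ r <= c%:E)%E -> intble P f /\ Ex P f <= c `^ r^-1.
Proof.
move=> r0 c0 mf f0 h.
have i0 : (0 <= \int[P]_w (f w)%:E)%E by apply: integral_ge0 => w _; rewrite lee_fin.
have hi : (\int[P]_w (f w)%:E <= (c `^ r^-1)%:E)%E.
  rewrite unlock in h.
  rewrite -[leLHS]poweRe1// -(mulfV (lt0r_neq0 r0)) poweRrM -poweR_EFin.
  apply: gt0_ler_poweR h; rewrite ?invr_ge0 ?(ltW r0)//.
    by rewrite in_itv/= leey poweR_ge0.
  by rewrite in_itv/= leey lee_fin c0.
have ifin : (\int[P]_w (f w)%:E < +oo)%E by rewrite (le_lt_trans hi)// ltry.
split; last by rewrite -lee_fin /Ex /Rintegral fineK// ge0_fin_numE.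
apply/integrableP; split; first exact/measurable_EFinP.
by under eq_integral do rewrite /= ger0_norm//.
Qed.

Lemma measurable_fun_norm_powR d' (T' : measurableType d') (f : T' -> R) s :
  measurable_fun setT f -> measurable_fun setT (fun w => `|f w| `^ s).
Proof.
move=> mf; apply: (@measurableT_comp _ _ _ _ _ _ (fun x : R => x `^ s)).
  exact: measurable_powR.
exact: measurableT_comp.
Qed.

(** From [x <= e / 2 + x^2 / (2 e)]. *)
Lemma Ex_abs_le_sqr (f : T -> R) (e : R) : 0 < e -> measurable_fun setT f ->
  intble P (fun w => `|f w| ^+ 2) -> Ex P (fun w => `|f w| ^+ 2) <= e ^+ 2 ->
  intble P f /\ Ex P (fun w => `|f w|) <= e.
Proof.
move=> e0 mf i2 E2.
have dom w : `| `|f w| | <= e / 2 + (2 * e)^-1 * `|f w| ^+ 2.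
  rewrite normr_id -subr_ge0.
  have -> : e / 2 + (2 * e)^-1 * `|f w| ^+ 2 - `|f w| = (e - `|f w|) ^+ 2 / (2 * e).
    by field; rewrite gt_eqF.
  by rewrite divr_ge0 ?sqr_ge0// mulr_ge0// ltW.
have ig : intble P (fun w => e / 2 + (2 * e)^-1 * `|f w| ^+ 2).
  by apply: intbleD; [exact: intble_cst|exact: intbleZ].
have mn : measurable_fun setT (fun w => `|f w|) by exact: measurableT_comp.
split; first by apply: (intble_le mf _ ig) => w; have := dom w; rewrite normr_id.
rewrite (le_trans (ler_norm _))// (le_trans (Ex_norm_le mn ig dom))//.
rewrite ExD; [rewrite (ExZ _ i2) Ex_cst|exact: intble_cst|exact: intbleZ].
apply: (@le_trans _ _ (e / 2 + (2 * e)^-1 * e ^+ 2)).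
  by rewrite lerD2l ler_wpM2l// invr_ge0 mulr_ge0// ltW.
by rewrite le_eqVlt; apply/orP; left; apply/eqP; field; rewrite gt_eqF.
Qed.

End moments_from_norms.

Lemma array_sup_ub (R : realType) (f : nat -> nat -> \bar R) n t :
  (1 <= t <= n)%N -> (f n t <= array_sup f)%E.
Proof. by move=> tn; apply: ereal_sup_ubound; exists (n, t). Qed.

Section row_moments_of_hypotheses.
Context {R : realType} {dO dS : measure_display}.
Context {Omega : measurableType dO} {S : measurableType dS}.
Variables (P : probability Omega R) (X : nat -> nat -> Omega -> S).
Hypothesis X_meas : forall n t, (1 <= t <= n)%N -> measurable_fun setT (X n t).
Variables (g : R) (Q : nat).
Hypothesis g0 : 0 < g.
Hypothesis Q2 : (2 <= Q)%N.

Let g2 : 0 < 2 + g. Proof. by rewrite addr_gt0. Qed.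

Let exp0 j : (0 < j)%N -> 0 < moment_exp g j.
Proof. by move=> j0; rewrite mulr_gt0 ?ltr0n// divr_gt0. Qed.

Let mhX (h : S -> R) n t : measurable_fun setT h -> (1 <= t <= n)%N ->
  measurable_fun setT (fun w => h (X n t w)).
Proof. by move=> mh tn; apply: (measurableT_comp mh); exact: X_meas. Qed.

(** The exponent [2 / (2 + g)] makes [theta^(2+g)] the square of eps. *)
Lemma row_moments_bounding n (b h : S -> R) (eps : R) : 0 < eps ->
  measurable_fun setT b -> measurable_fun setT h ->
  (forall x, `|h x| <= `|b x|) ->
  (forall i, (2 <= i <= Q)%N ->
     (array_sup (fun n t => 'E_P[fun w => (`|b (X n t w)| `^ moment_exp g i)%R]
        `^ (2^-1)%R) <= eps%:E)%E) ->
  row_moments P X g Q n h (eps `^ (2 / (2 + g))).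
Proof.
move=> e0 mb mh hb bm; split => // t j tn jQ.
have [|||||ib Eb] := @expectation_poweR_le _ _ _ P
    (fun w => `|b (X n t w)| `^ moment_exp g j) 2^-1 eps.
- by rewrite invr_gt0.
- exact: ltW.
- by apply: measurable_fun_norm_powR; exact: mhX.
- by move=> w; exact: powR_ge0.
- exact: le_trans (array_sup_ub _ tn) (bm j jQ).
have mH : measurable_fun setT (fun w => `|h (X n t w)| `^ moment_exp g j).
  by apply: measurable_fun_norm_powR; exact: mhX.
have pt w : `| `|h (X n t w)| `^ moment_exp g j | <= `|b (X n t w)| `^ moment_exp g j.
  rewrite ger0_norm ?powR_ge0//; apply: ge0_ler_powR; rewrite ?nnegrE//.
  by rewrite ltW// exp0//; case/andP: jQ; case: (j).
have iH := intble_le mH pt ib.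
split=> //; rewrite (le_trans (Ex_le iH ib _)) => [|w|]//.
  by apply: le_trans (pt w); exact: ler_norm.
rewrite (le_trans Eb)// invrK -powRrM divfK ?lt0r_neq0// .
Qed.

(** The lower moments are bounded by the highest one through [x^sj <= delta^sj
    + delta^(sj - sQ) * x^sQ]; the two terms account for the factor 2. *)
Lemma row_moments_dist n (phi psi : S -> R) (delta : R) : 0 < delta <= 1 ->
  measurable_fun setT phi -> measurable_fun setT psi ->
  (array_dist P X Q g phi psi < delta%:E)%E ->
  row_moments P X g Q n (fun x => phi x - psi x) (2 * delta).
Proof.
move=> /andP[d0 d1] mphi mpsi hd; have mh := measurable_funB mphi mpsi.
split => // t j tn /andP[j2 jQ].
set h := fun x => phi x - psi x in mh *.
pose sQ := moment_exp g Q; pose sj := moment_exp g j.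
have sQ0 : 0 < sQ by apply: exp0; rewrite (leq_trans _ Q2).
have sj0 : 0 < sj by apply: exp0; rewrite (leq_trans _ j2).
have [|||||iQ EQ] := @expectation_poweR_le _ _ _ P
    (fun w => `|h (X n t w)| `^ sQ) sQ^-1 delta.
- by rewrite invr_gt0.
- exact: ltW.
- by apply: measurable_fun_norm_powR; exact: mhX.
- by move=> w; exact: powR_ge0.
- rewrite (_ : sQ^-1 = Q%:R^-1 * (2 / (2 + g))).
    exact: le_trans (array_sup_ub _ tn) (ltW hd).
  rewrite /sQ /moment_exp; field.
  by rewrite (lt0r_neq0 g2) pnatr_eq0 -lt0n (leq_trans _ Q2).
rewrite invrK in EQ.
have mH : measurable_fun setT (fun w => `|h (X n t w)| `^ sj).
  by apply: measurable_fun_norm_powR; exact: mhX.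
have ds0 s : 0 < delta `^ s by exact: powR_gt0.
have sjQ : sj <= sQ by rewrite /sj /sQ /moment_exp ler_wpM2r ?ler_nat// divr_ge0 ?ltW.
have pt w : `| `|h (X n t w)| `^ sj | <=
    delta `^ sj + delta `^ sj / delta `^ sQ * `|h (X n t w)| `^ sQ.
  rewrite ger0_norm ?powR_ge0//.
  have [hd1|hd1] := leP `|h (X n t w)| delta.
    apply: ler_wpDr; first by rewrite mulr_ge0 ?powR_ge0// divr_ge0 ?powR_ge0.
    by apply: ge0_ler_powR; rewrite ?nnegrE ?(ltW d0)// ltW.
  apply: ler_wpDl; first exact: ltW.
  have h0 : 0 < `|h (X n t w)| by exact: lt_trans hd1.
  rewrite -powRB ?(lt0r_neq0 d0) ?implybT//.
  rewrite [leLHS](_ : _ = `|h (X n t w)| `^ (sj - sQ) * `|h (X n t w)| `^ sQ); last first.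
    by rewrite -powRD ?(lt0r_neq0 h0) ?implybT// subrK.
  rewrite ler_wpM2r ?powR_ge0// -[sj - sQ]opprB !powRN lef_pV2 ?posrE ?powR_gt0//.
  by apply: ge0_ler_powR; rewrite ?nnegrE ?subr_ge0 ?(ltW d0)// ltW.
have ig : intble P (fun w => delta `^ sj + delta `^ sj / delta `^ sQ * `|h (X n t w)| `^ sQ).
  by apply: intbleD; [exact: intble_cst|exact: intbleZ].
split; first exact: intble_le mH pt ig.
rewrite (le_trans (ler_norm _))// (le_trans (Ex_norm_le mH ig pt))//.
rewrite ExD; [rewrite (ExZ _ iQ) Ex_cst|exact: intble_cst|exact: intbleZ].
apply: (@le_trans _ _ (delta `^ sj + delta `^ sj / delta `^ sQ * delta `^ sQ)).
  by rewrite lerD2l ler_wpM2l// divr_ge0 ?powR_ge0.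
rewrite divfK ?lt0r_neq0// -mulr2n -[leLHS]mulr_natl powRM ?(ltW d0)//.
have hj : 2 <= j%:R :> R by rewrite ler_nat.
rewrite ler_pM ?powR_ge0//.
  by rewrite -[leLHS]powRr1// ler_powR ?ler1n// (le_trans _ (ltW _ : 2 <= 2 + g))// ?ler1n// ltrDl.
apply: ger_powR; first by rewrite d0.
by rewrite /sj /moment_exp; have := g0; nra.
Qed.

Lemma bracket_mean n t (b : S -> R) (eps : R) : 0 < eps -> (1 <= t <= n)%N ->
  measurable_fun setT b -> (array_rho P X b < eps%:E)%E ->
  intble P (fun w => b (X n t w)) /\ Ex P (fun w => `|b (X n t w)|) <= eps.
Proof.
move=> e0 tn mb hb.
have [|||||i2 E2] := @expectation_poweR_le _ _ _ P
    (fun w => `|b (X n t w)| ^+ 2) 2^-1 eps.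
- by rewrite invr_gt0.
- exact: ltW.
- by apply: measurable_funX; apply: measurableT_comp => //; exact: mhX.
- by move=> w; exact: exprn_ge0.
- exact: le_trans (array_sup_ub _ tn) (ltW hb).
apply: Ex_abs_le_sqr => //; first exact: mhX.
by rewrite (le_trans E2)// invrK powR_mulrn// ltW.
Qed.

End row_moments_of_hypotheses.

(** * The entropy integral *)

(** The integral of a nonnegative function is a supremum over the simple
    functions below it, so it is monotone without measurability; this avoids
    discussing the measurability of the bracketing number. *)
Lemma ge0_le_integral_nonmeasurable d (T : measurableType d) (R : realType)
    (mu : {measure set T -> \bar R}) (f1 f2 : T -> \bar R) :
  (forall x, 0 <= f1 x)%E -> (forall x, f1 x <= f2 x)%E ->
  (\int[mu]_x f1 x <= \int[mu]_x f2 x)%E.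
Proof.
move=> f10 f12; have f20 x : (0 <= f2 x)%E by exact: le_trans (f12 x).
rewrite !ge0_integralTE//; apply: ereal_sup_le => _ [h /= hf <-].
by exists h => // x; exact: le_trans (f12 x).
Qed.

Section entropy.
Context {R : realType}.

Let dy (k : nat) : R := 2^-1 ^+ k.

Let dyS k : dy k.+1 = dy k / 2. Proof. by rewrite /dy exprSr. Qed.
Let dy_gt0 k : 0 < dy k. Proof. by rewrite exprn_gt0// invr_gt0. Qed.

Let dy_le j k : (j <= k)%N -> dy k <= dy j.
Proof.
move=> jk; rewrite /dy; apply: ler_wiXn2l jk; rewrite ?invr_ge0//.
by rewrite invf_le1// ler1n.
Qed.

(** The step function with values [v k] on the dyadic intervals lies below
    f. *)
Lemma dyadic_sum_le_integral (f : R -> \bar R) (v : nat -> R) (K : nat) :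
  (forall k, 0 <= v k) ->
  (forall x : R, 0 < x <= 1 -> (0 <= f x)%E) ->
  (forall k (x : R), dy k.+1 < x <= dy k -> ((v k)%:E <= f x)%E) ->
  ((\sum_(k < K) v k * dy k.+1)%:E <=
     \int[lebesgue_measure]_(x in `]0%R, 1%R]) f x)%E.
Proof.
move=> v0 f0 vf.
pose E (k : nat) : set R := `]dy k.+1, dy k]%classic.
have mE k : measurable (E k) by exact: measurable_itv.
have muE k : lebesgue_measure (E k) = (dy k.+1)%:E :> \bar R.
  rewrite lebesgue_measure_itv/= lte_fin dyS.
  have := dy_gt0 k => dk; rewrite ifT; last by lra.
  by rewrite -EFinB; congr (_%:E); lra.
have -> : ((\sum_(k < K) v k * dy k.+1)%:E =
   \int[lebesgue_measure]_x (\sum_(k < K) (v k * \1_(E k) x)%:E))%E.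
  rewrite ge0_integral_sum//.
  - rewrite -sumEFin; apply: eq_bigr => k _.
    transitivity ((v k)%:E * \int[lebesgue_measure]_x (\1_(E k) x)%:E)%E.
      rewrite integral_indic//; last exact: mE.
      by rewrite -[X in (_ = _ * X)%E]/(lebesgue_measure (E k `&` setT)) setIT muE.
    have vneg : v k < 0 -> E k = set0 by move=> /lt_geF; rewrite v0.
    exact/esym/(@integralZl_indic _ _ _ lebesgue_measure setT measurableT
      (fun=> E k) (v k) vneg (mE k)).
  - move=> k; apply/measurable_EFinP; apply: measurable_funM.
      exact: measurable_cst.
    by apply: measurable_indic; exact: mE.
  - by move=> k x _; rewrite lee_fin mulr_ge0.
rewrite [leRHS]integral_mkcond; apply: ge0_le_integral_nonmeasurable => x.
  by apply: sume_ge0 => k _; rewrite lee_fin mulr_ge0.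
have fD0 : (0 <= (f \_ `]0%R, 1%R]) x)%E.
  by apply: erestrict_ge0 => y /=; rewrite in_itv/=; exact: f0.
have [/existsP[k0 /asboolP Ek0]|/existsPn noE] := boolP [exists k : 'I_K, `[< E k x >]]; last first.
  rewrite big1// => k _; rewrite indicE memNset ?mulr0//.
  by have /asboolP := noE k.
rewrite (bigD1 k0)//= big1 ?adde0 => [|k kk0].
  rewrite indicE mem_set// mulr1.
  have := Ek0; rewrite /E/= in_itv/= => xE; have /andP[x0 x1] := xE.
  rewrite patchE mem_set; first exact: vf.
  rewrite /= in_itv/= (lt_trans _ x0)//= (le_trans x1)//.
  by rewrite -[leRHS](expr0 2^-1); exact: (dy_le (leq0n _)).
rewrite indicE memNset ?mulr0// => Ek.
have := Ek0; have := Ek; rewrite /E/= !in_itv/= => /andP[a1 a2] /andP[b1 b2].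
have [kk|kk|kk] := ltngtP k k0.
- by have := dy_le kk; rewrite leNgt (lt_le_trans a1 b2).
- by have := dy_le kk; rewrite leNgt (lt_le_trans b1 a2).
- by move: kk0; rewrite (ord_inj kk) eqxx.
Qed.

Context {dS : measure_display} {S : measurableType dS}.
Variables (F : set (S -> R)) (rho : (S -> R) -> \bar R).

Lemma bracketing_number_le eps eps' : eps <= eps' ->
  (bracketing_number eps' F rho <= bracketing_number eps F rho)%E.
Proof.
move=> ee'; apply: ereal_inf_le_tmp => _ [N [B [A [BA BN rB cov]]] <-].
exists N => //; exists B, A; split => // b Bb.
by rewrite (lt_le_trans (rB b Bb))// lee_fin.
Qed.

Lemma bracketing_number_ge0 eps : (0 <= bracketing_number eps F rho)%E.
Proof. by apply: le_ereal_inf_tmp => _ [N _ <-]; rewrite lee_fin. Qed.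

Variables (g : R) (Q : nat) (N : nat -> nat).
Hypothesis g0 : 0 < g.
Hypothesis NE : forall k, bracketing_number (dy k) F rho = (N k)%:R%:E.

(** The bracketing number decreases in eps, so on the k-th dyadic interval the
    integrand is at least its value at the right end point, and the interval
    has half the length of this end point. *)
Lemma entropy_sum_bounded :
  (\int[lebesgue_measure]_(x in `]0%R, 1%R])
     ((x `^ (- (g / (2 + g))))%R%:E *
      bracketing_number x F rho `^ (Q%:R^-1)%R) < +oo)%E ->
  exists C : R, forall K,
    \sum_(k < K) (N k)%:R `^ Q%:R^-1 * dy k `^ (2 / (2 + g)) <= C.
Proof.
set I := (\int[_]_(x in _) _)%E => Ifin.
have g2 : 0 < 2 + g by rewrite addr_gt0.
have I0 : (0 <= I)%E.
  by apply: integral_ge0 => x _; rewrite mule_ge0 ?poweR_ge0// lee_fin powR_ge0.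
exists (2 * fine I) => K.
pose v k := dy k `^ (- (g / (2 + g))) * (N k)%:R `^ Q%:R^-1.
have := @dyadic_sum_le_integral (fun x => ((x `^ (- (g / (2 + g))))%R%:E *
      bracketing_number x F rho `^ (Q%:R^-1)%R)%E) v K.
rewrite -/I -[I]fineK ?ge0_fin_numE// lee_fin.
move=> h; rewrite -ler_pdivrMl// mulr_sumr.
apply: le_trans (h _ _ _).
- rewrite le_eqVlt; apply/orP; left; apply/eqP; apply: eq_bigr => k _.
  rewrite /v dyS mulrA [LHS]mulrC; congr (_ * _).
  rewrite [LHS]mulrC [RHS]mulrAC; congr (_ * _).
  rewrite -[X in _ = _ * X]powRr1 ?(ltW (dy_gt0 _))// -powRD ?(lt0r_neq0 (dy_gt0 _)) ?implybT//.
  by congr (_ `^ _); field; rewrite gt_eqF.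
- by move=> k; rewrite mulr_ge0 ?powR_ge0.
- by move=> x _; rewrite mule_ge0 ?poweR_ge0// lee_fin powR_ge0.
move=> k x /andP[x1 x2]; have x0 : 0 < x by rewrite (lt_trans _ x1).
rewrite /v EFinM -[X in (_ * X <= _)%E]poweR_EFin; apply: lee_pmul.
- by rewrite lee_fin powR_ge0.
- exact: poweR_ge0.
- rewrite lee_fin !powRN lef_pV2 ?posrE ?powR_gt0//.
  apply: ge0_ler_powR; rewrite ?nnegrE ?(ltW x0) ?(ltW (dy_gt0 _))//.
  by rewrite divr_ge0 ?ltW.
apply: gt0_ler_poweR; rewrite ?invr_ge0 ?ler0n//.
- by rewrite in_itv/= leey lee_fin ler0n.
- by rewrite in_itv/= leey bracketing_number_ge0.
- by rewrite -NE; exact: bracketing_number_le.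
Qed.

End entropy.

(** * Chaining *)

Section chaining.
Context {R : realType} {dO dS : measure_display}.
Context {Omega : measurableType dO} {S : measurableType dS}.
Variables (P : probability Omega R) (X : nat -> nat -> Omega -> S).
Hypothesis X_meas : forall n t, (1 <= t <= n)%N -> measurable_fun setT (X n t).
Variables (g : R) (Q : nat) (W : R).
Hypothesis g0 : 0 < g.
Hypothesis Q2 : (2 <= Q)%N.
Hypothesis Q_even : ~~ odd Q.
Hypothesis W0 : 0 <= W.
Hypothesis rate_sum : forall n,
  \sum_(1 <= r < n) r%:R ^+ (Q - 2) * mix_rate P X r `^ (g / (2 + g)) <= W.
Variable F : set (S -> R).
Hypothesis F_meas : forall phi, F phi -> measurable_fun setT phi.
Hypothesis F_int : forall phi n t, F phi -> (1 <= t <= n)%N ->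
  intble P (fun w => phi (X n t w)).

Definition dyadic (k : nat) : R := 2^-1 ^+ k.
(** The theta for which the brackets of size [2^-k] satisfy [row_moments]. *)
Definition level_scale (k : nat) : R := dyadic k `^ (2 / (2 + g)).

Variables (N : nat -> nat) (a b : forall k, 'I_(N k) -> S -> R).
Hypothesis aF : forall k i, F (@a k i).
Hypothesis b_meas : forall k j, measurable_fun setT (@b k j).
Hypothesis b_row : forall k j n (h : S -> R), measurable_fun setT h ->
  (forall x, `|h x| <= `|@b k j x|) -> row_moments P X g Q n h (level_scale k).
Hypothesis b_mean : forall k j n t, (1 <= t <= n)%N ->
  intble P (fun w => @b k j (X n t w)) /\
  Ex P (fun w => `|@b k j (X n t w)|) <= dyadic k.
Hypothesis bracket : forall k phi, F phi ->
  exists i j, forall x, `|phi x - @a k i x| <= @b k j x.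

Let C := empirical_const g Q W.
Let G n h := empirical_process P X n 1 h.
Let g2 : 0 < 2 + g. Proof. by rewrite addr_gt0. Qed.
Let Q0 : (0 < Q)%N. Proof. by rewrite (leq_trans _ Q2). Qed.
Let C0 : 0 <= C. Proof. exact: empirical_const_ge0. Qed.

Let dyadic_gt0 k : 0 < dyadic k.
Proof. by rewrite exprn_gt0// invr_gt0. Qed.

Lemma level_scale_gt0 k : 0 < level_scale k.
Proof. exact: powR_gt0. Qed.

Definition scale_ratio : R := 2 `^ (2 / (2 + g)).

Lemma level_scaleS k : level_scale k = scale_ratio * level_scale k.+1.
Proof.
rewrite /level_scale /scale_ratio -powRM ?(ltW (dyadic_gt0 _))//.
by rewrite /dyadic exprS mulrA mulfV// mul1r.
Qed.

Lemma scale_ratio_ge1 : 1 <= scale_ratio.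
Proof.
rewrite -[leLHS](powRr0 2); apply: ler_powR; first by rewrite ler1n.
by rewrite divr_ge0 ?ltW.
Qed.

Lemma level_scale_le k : level_scale k.+1 <= level_scale k.
Proof.
by rewrite [leRHS]level_scaleS ler_peMl ?scale_ratio_ge1// ltW// level_scale_gt0.
Qed.

Lemma empirical_processB n phi psi w : F phi -> F psi ->
  G n phi w - G n psi w = G n (fun x => phi x - psi x) w.
Proof.
move=> Fphi Fpsi; rewrite /G !empirical_process1E -mulrBr -sumrB; congr (_ * _).
apply: eq_bigr => i _; have it : (1 <= i.+1 <= n)%N by rewrite ltn_ord.
rewrite (_ : Ex P ((fun x => phi x - psi x) \o X n i.+1) =
   Ex P (phi \o X n i.+1) - Ex P (psi \o X n i.+1)); first by rewrite /=; ring.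
exact: (ExB (F_int Fphi it) (F_int Fpsi it)).
Qed.

(** Replacing h by b in the centred sum costs twice the mean of |b| per
    summand, hence the bias [2 sqrt n * eps_k]. *)
Lemma empirical_process_bracket n k j (h : S -> R) w : (0 < n)%N ->
  measurable_fun setT h -> (forall x, `|h x| <= @b k j x) ->
  `|G n h w| <= `|G n (@b k j) w| + 2 * (Num.sqrt n%:R * dyadic k).
Proof.
move=> n0 mh hb.
have sn0 : 0 < Num.sqrt n%:R :> R by rewrite sqrtr_gt0 ltr0n.
rewrite /G !empirical_process1E.
have -> : 2 * (Num.sqrt n%:R * dyadic k) = (Num.sqrt n%:R)^-1 * (\sum_(i < n) 2 * dyadic k).
  have sq : n%:R = Num.sqrt n%:R ^+ 2 :> R by rewrite sqr_sqrtr.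
  rewrite sumr_const card_ord -[X in _ = _ * X](mulr_natl _ n) [X in _ = _ * (X * _)]sq.
  by field; rewrite gt_eqF.
rewrite !normrM !(ger0_norm (_ : 0 <= (Num.sqrt n%:R)^-1)) ?invr_ge0 ?(ltW sn0)//.
rewrite -mulrDr ler_pM2l ?invr_gt0//.
apply: le_trans (ler_norm_sum _ _ _) _.
apply: le_trans (lerD (ler_norm _) (lexx _)); rewrite -big_split/=.
apply: ler_sum => i _; have it : (1 <= i.+1 <= n)%N by rewrite ltn_ord.
have [ib Eb] := @b_mean k j n i.+1 it.
have mhX : measurable_fun setT (h \o X n i.+1).
  by apply: measurableT_comp => //; exact: X_meas.
have Eh : `|Ex P (h \o X n i.+1)| <= dyadic k.
  apply: le_trans Eb; apply: Ex_norm_le => //; first exact: intble_norm.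
  by move=> x; rewrite /= (le_trans (hb _))// ler_norm.
have Eb' : Ex P (@b k j \o X n i.+1) <= dyadic k.
  by apply: le_trans Eb; rewrite (le_trans (ler_norm _))//; exact: (Ex_norm ib).
rewrite (le_trans (ler_normB _ _))//; have := hb (X n i.+1 w).
by move: Eh Eb'; set e1 := Ex _ _; set e2 := Ex _ _ => Eh Eb' h1; lra.
Qed.

Definition entropy_term (k : nat) : R := (N k)%:R `^ Q%:R^-1 * level_scale k.

Lemma entropy_term_ge0 k : 0 <= entropy_term k.
Proof. by rewrite mulr_ge0 ?powR_ge0. Qed.

(** The process of a function is, up to the bias, within |G b| of that of its
    approximating function; only the N_k bounding functions b enter the
    maximum. *)
Lemma top_bracket n k : (0 < n)%N -> 1 <= n%:R * level_scale k ^+ 2 ->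
  exists V, [/\ forall w, 0 <= V w,
    Lnorm_le P Q V (C * entropy_term k + 2 * (Num.sqrt n%:R * dyadic k)) &
    forall phi, F phi -> exists i, forall w, `|G n phi w - G n (@a k i) w| <= V w].
Proof.
move=> n0 nk.
have Gb j : Lnorm_le P Q (G n (@b k j)) (C * level_scale k).
  apply: Lnorm_le_empirical => //; first exact: level_scale_gt0.
  exact: b_row.
have [V [V0 Vb LV]] := Lnorm_le_max Q0 (mulr_ge0 C0 (ltW (level_scale_gt0 k))) Gb.
have c0 : 0 <= 2 * (Num.sqrt n%:R * dyadic k).
  by rewrite !mulr_ge0 ?sqrtr_ge0// ltW.
exists (fun w => V w + 2 * (Num.sqrt n%:R * dyadic k)); split.
- by move=> w; rewrite addr_ge0.
- apply: (Lnorm_le_add Q0) => //; last exact: (Lnorm_le_cst P Q0 c0).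
  by move: LV; rewrite card_ord mulrCA.
move=> phi Fphi; have [i [j hb]] := bracket k Fphi; exists i => w.
rewrite empirical_processB//.
apply: (le_trans (empirical_process_bracket _ n0 _ hb)).
  by apply: measurable_funB; [exact: F_meas|apply: F_meas; exact: aF].
by rewrite lerD2r Vb.
Qed.

(** Each approximating function of level k+1 is in F, hence bracketed at level
    k; choosing one such bracket gives N_(k+1) links of size [theta_k] between
    the two levels. *)
Lemma chain_links n k0 m : (0 < n)%N -> 1 <= n%:R * level_scale (k0 + m) ^+ 2 ->
  exists V, [/\ forall w, 0 <= V w,
    Lnorm_le P Q V (C * scale_ratio * \sum_(k0 <= k < k0 + m) entropy_term k.+1) &
    forall i : 'I_(N (k0 + m)), exists i0,
      forall w, `|G n (@a (k0 + m) i) w - G n (@a k0 i0) w| <= V w].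
Proof.
move=> n0; elim: m => [|m IH].
  rewrite addn0 => _; exists (fun=> 0); split=> [//||i].
    by rewrite big_geq// mulr0; exact: Lnorm_le_cst.
  by exists i => w; rewrite subrr normr0.
rewrite addnS => nk.
have nk' : 1 <= n%:R * level_scale (k0 + m) ^+ 2.
  rewrite (le_trans nk)// ler_wpM2l// lerXn2r ?nnegrE ?(ltW (level_scale_gt0 _))//.
  exact: level_scale_le.
have [V [V0 LV VP]] := IH nk'.
have /choice[pi piP] : forall i : 'I_(N (k0 + m).+1), exists i' : 'I_(N (k0 + m)),
    Lnorm_le P Q (fun w => G n (@a _ i) w - G n (@a _ i') w) (C * level_scale (k0 + m)).
  move=> i; have [i' [j hb]] := bracket (k0 + m) (aF i); exists i'.
  rewrite (_ : (fun w => _) = G n (fun x => @a _ i x - @a _ i' x)); last first.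
    by apply/funext => w; rewrite empirical_processB//; exact: aF.
  apply: Lnorm_le_empirical => //; first exact: level_scale_gt0.
  apply: (b_row (j := j)).
    by apply: measurable_funB; apply: F_meas; exact: aF.
  by move=> x; rewrite (le_trans (hb x))// ler_norm.
have [V' [V'0 V'b LV']] :=
  Lnorm_le_max Q0 (mulr_ge0 C0 (ltW (level_scale_gt0 (k0 + m)))) piP.
exists (fun w => V w + V' w); split=> [w||i].
- by rewrite addr_ge0.
- rewrite big_nat_recr ?leq_addr//= mulrDr; apply: (Lnorm_le_add Q0) => //.
  move: LV'; rewrite card_ord [in X in Lnorm_le _ _ _ X]level_scaleS.
  by rewrite /entropy_term; congr Lnorm_le; ring.
have [i0 i0P] := VP (pi i); exists i0 => w.
by rewrite (le_trans (ler_distD (G n (@a _ (pi i)) w) _ _))// addrC lerD// V'b.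
Qed.

Definition chain_bound n k0 K : R :=
  C * scale_ratio * \sum_(k0 <= k < K) entropy_term k.+1 +
  (C * entropy_term K + 2 * (Num.sqrt n%:R * dyadic K)).

Lemma chain_to_coarse n k0 K : (0 < n)%N -> (k0 <= K)%N ->
  1 <= n%:R * level_scale K ^+ 2 ->
  exists V, [/\ forall w, 0 <= V w, Lnorm_le P Q V (chain_bound n k0 K) &
    forall phi, F phi -> exists i0, forall w, `|G n phi w - G n (@a k0 i0) w| <= V w].
Proof.
move=> n0 /subnKC <-; move: (K - k0)%N => m nk.
have [V [V0 LV VP]] := chain_links n0 nk.
have [V' [V'0 LV' V'P]] := top_bracket n0 nk.
exists (fun w => V w + V' w); split=> [w||phi Fphi].
- by rewrite addr_ge0.
- exact: Lnorm_le_add.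
have [i iP] := V'P phi Fphi; have [i0 i0P] := VP i; exists i0 => w.
apply: (le_trans (ler_distD (G n (@a _ i) w) _ _)).
by rewrite [leRHS]addrC; apply: lerD; [exact: iP|exact: i0P].
Qed.

(** Two functions of F are replaced by their coarse approximations (two errors
    V), whose difference is compared with that of the chosen representatives
    of the pair (two more errors V). *)
Lemma chaining_bound n k0 K delta : (0 < n)%N -> (k0 <= K)%N ->
  1 <= n%:R * level_scale K ^+ 2 -> 0 < delta <= 1 -> 1 <= n%:R * (2 * delta) ^+ 2 ->
  exists U, [/\ forall w, 0 <= U w,
    Lnorm_le P Q U (4 * chain_bound n k0 K +
      (N k0 * N k0)%:R `^ Q%:R^-1 * (C * (2 * delta))) &
    forall phi psi, F phi -> F psi -> (array_dist P X Q g phi psi < delta%:E)%E ->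
      forall w, `|G n phi w - G n psi w| <= U w].
Proof.
move=> n0 k0K nK d01 nd; have /andP[d0 d1] := d01.
have [V [V0 LV VP]] := chain_to_coarse n0 k0K nK.
pose close phi i := forall w, `|G n phi w - G n (@a k0 i) w| <= V w.
have Cd0 : 0 <= C * (2 * delta) by rewrite mulr_ge0// mulr_ge0// ltW.
have /choice[D DP] : forall p : 'I_(N k0) * 'I_(N k0), exists D : Omega -> R,
    Lnorm_le P Q D (C * (2 * delta)) /\
    forall phi psi, F phi -> F psi -> (array_dist P X Q g phi psi < delta%:E)%E ->
      close phi p.1 -> close psi p.2 ->
      forall w, `|G n (@a k0 p.1) w - G n (@a k0 p.2) w| <= 2 * V w + `|D w|.
  move=> [i j].
  have [[phi [psi [Fphi Fpsi dist ci cj]]]|none] := pselect (exists phi psi,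
    [/\ F phi, F psi, (array_dist P X Q g phi psi < delta%:E)%E,
        close phi i & close psi j]); last first.
    exists (fun=> 0); split.
      by apply: (Lnorm_le_trans Cd0); exact: Lnorm_le_cst.
    by move=> phi psi Fphi Fpsi dist ci cj; case: none; exists phi, psi.
  exists (fun w => G n phi w - G n psi w); split.
    rewrite (_ : (fun w => _) = G n (fun x => phi x - psi x)); last first.
      by apply/funext => w; exact: empirical_processB.
    apply: Lnorm_le_empirical => //; first by rewrite mulr_gt0.
    by apply: row_moments_dist => //; exact: F_meas.
  move=> _ _ _ _ _ _ _ w /=.
  have := ci w; have := cj w.
  rewrite -[X in `|X - _| <= _ + _](subrK (G n phi w)).
  move=> h1 h2.
  rewrite (_ : _ - _ = - (G n phi w - G n (@a k0 i) w) + (G n phi w - G n psi w)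
     + (G n psi w - G n (@a k0 j) w)); last by ring.
  rewrite (le_trans (ler_normD _ _))// (le_trans (lerD (ler_normD _ _) (lexx _)))//.
  rewrite normrN; lra.
have [V' [V'0 V'b LV']] := Lnorm_le_max Q0 Cd0 (fun p => (DP p).1).
exists (fun w => (V w + V w + (V w + V w)) + V' w); split.
- by move=> w; rewrite !addr_ge0.
- apply: (Lnorm_le_add Q0); last by move: LV'; rewrite card_prod card_ord.
  rewrite (_ : 4 * _ = chain_bound n k0 K + chain_bound n k0 K +
    (chain_bound n k0 K + chain_bound n k0 K)); last by ring.
  by do 2 ! apply: (Lnorm_le_add Q0).
move=> phi psi Fphi Fpsi dist w.
have [i ci] := VP phi Fphi; have [j cj] := VP psi Fpsi.
have := (DP (i, j)).2 phi psi Fphi Fpsi dist ci cj w => /= h.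
have := V'b (i, j) w; have := ci w; have := cj w => h1 h2 h3.
rewrite (_ : _ - _ = (G n phi w - G n (@a k0 i) w) + (G n (@a k0 i) w - G n (@a k0 j) w)
     - (G n psi w - G n (@a k0 j) w)); last by ring.
rewrite (le_trans (ler_normB _ _))// (le_trans (lerD (ler_normD _ _) (lexx _)))//.
lra.
Qed.

End chaining.

(** * Passage to the limit *)

(** Families indexed by ordinals make the maximal inequality applicable to the
    bracketing classes. *)
Lemma enum_of_card (T : Type) (A : set T) (n : nat) : (A #= `I_n)%card ->
  exists e : 'I_n -> T, (forall i, A (e i)) /\ forall x, A x -> exists i, e i = x.
Proof.
rewrite card_eq_sym => /card_bijP[f [h fK hK]].
pose e (i : 'I_n) : T := val (f (exist _ (nat_of_ord i) (mem_set (ltn_ord i)))).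
exists e; split=> [i|x Ax]; first exact: set_valP.
pose y := h (exist _ x (mem_set Ax)).
have yn : (val y < n)%N by exact: set_valP y.
exists (Ordinal yn); rewrite /e -[RHS]/(val (exist (fun z => z \in A) x (mem_set Ax))).
rewrite -(hK (exist _ x (mem_set Ax))); congr (val (f _)).
exact: val_inj.
Qed.

Section real_facts.
Context {R : realType}.

Lemma bounded_series_tail (u : nat -> R) (c : R) : (forall k, 0 <= u k) ->
  (forall K, \sum_(k < K) u k <= c) ->
  forall e, 0 < e -> exists k0, forall K, \sum_(k0 <= k < K) u k <= e.
Proof.
move=> u0 uc e e0; pose E := range (fun K => \sum_(k < K) u k).
have supE : has_sup E.
  by split; [exists 0, 0%N => //; rewrite big_ord0|exists c => _ [K _ <-]].
have [_ [k0 _ <-] k0P] := sup_adherent e0 supE.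
exists k0 => K; have [Kk|kK] := leqP K k0; first by rewrite big_geq// ltW.
have : \sum_(k < K) u k <= sup E by apply: sup_upper_bound => //; exists K.
rewrite -(big_mkord xpredT u) (big_cat_nat (leq0n _) (ltnW kK))/= big_mkord.
by move: k0P; lra.
Qed.

Lemma dyadic_powR_small (c e : R) : 0 < c -> 0 < e ->
  exists k0, forall k, (k0 <= k)%N -> dyadic k `^ c < e.
Proof.
move=> c0 e0; pose e' := e `^ c^-1; have e'0 : 0 < e' by exact: powR_gt0.
exists (Num.truncn e'^-1).+1 => k hk.
have eE : e = e' `^ c by rewrite /e' -powRrM mulVf ?gt_eqF// powRr1 ?ltW.
have d0 : 0 < dyadic k :> R by rewrite exprn_gt0// invr_gt0.
rewrite eE; apply: gt0_ltr_powR; rewrite ?nnegrE ?(ltW d0) ?(ltW e'0)//.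
rewrite /dyadic exprVn invf_plt ?posrE ?exprn_gt0//.
apply: (lt_trans (truncnS_gt _)); apply: (@le_lt_trans _ _ k%:R).
  by rewrite ler_nat.
by rewrite -natrX ltr_nat ltn_expl.
Qed.

(** The value -oo is the outer expectation of a supremum over an empty
    class. *)
Lemma poweR_le_of_nonneg (x y : \bar R) (r : R) : 0 < r ->
  (x = -oo \/ 0 <= x)%E -> (x <= y)%E -> (0 <= y)%E -> (x `^ r <= y `^ r)%E.
Proof.
move=> r0 [->|x0] xy y0; first by rewrite poweRNyr ?gt_eqF// poweR_ge0.
by apply: gt0_ler_poweR => //; rewrite ?(ltW r0)// in_itv/= leey ?x0 ?y0.
Qed.

Lemma limn_esup_le_eventually (u : nat -> \bar R) (c : \bar R) n0 :
  (forall n, (n0 <= n)%N -> (u n <= c)%E) -> (limn_esup u <= c)%E.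
Proof.
move=> uc; apply: (@le_trans _ _ (ereal_sup (u @` [set n | (n0 <= n)%N]))).
  by apply: ereal_inf_lbound; exists [set n | (n0 <= n)%N] => //; exact: nbhs_infty_ge.
by apply: ge_ereal_sup => _ [n nn0 <-]; exact: uc.
Qed.

Lemma cvge_right0 (L : R -> \bar R) : (forall d, (0 <= L d)%E) ->
  (forall e, 0 < e -> exists2 d0, 0 < d0 & forall d, 0 < d < d0 -> (L d <= e%:E)%E) ->
  (L d @[d --> (0 : R)%R^'+] --> (0 : \bar R))%E.
Proof.
move=> L0 Le; apply/fine_cvgP; split.
  have [d0 d00 Ld] := Le 1 ltr01; near=> d.
  have dd : 0 < d < d0.
    by apply/andP; split; near: d; [exact: nbhs_right_gt|exact: nbhs_right_lt].
  by rewrite ge0_fin_numE// (le_lt_trans (Ld d dd))// ltry.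
apply/cvgrPdist_le => e e0; have [d0 d00 Ld] := Le e e0; near=> d.
have dd : 0 < d < d0.
  by apply/andP; split; near: d; [exact: nbhs_right_gt|exact: nbhs_right_lt].
have fd : L d \is a fin_num.
  by rewrite ge0_fin_numE// (le_lt_trans (Ld d dd))// ltry.
by rewrite sub0r normrN ger0_norm ?fine_ge0//= -lee_fin fineK// Ld.
Unshelve. all: by end_near.
Qed.

End real_facts.

Section fine_level.
Context {R : realType}.
Variable g : R.
Hypothesis g0 : 0 < g.
Let g2 : 0 < 2 + g. Proof. by rewrite addr_gt0. Qed.

(** The last level at which the moment inequality applies. *)
Lemma finest_level (k0 n : nat) : 1 <= n%:R * level_scale g k0 ^+ 2 ->
  exists K, [/\ (k0 <= K)%N, 1 <= n%:R * level_scale g K ^+ 2 &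
    n%:R * level_scale g K.+1 ^+ 2 < 1].
Proof.
move=> nk0; (* K + 1 is the first level at which the bound fails *)
pose p k := (k0 <= k)%N && (n%:R * level_scale g k ^+ 2 < 1).
have exp0 : exists k, p k.
  have n0 : 0 < n%:R :> R.
    by rewrite ltr0n; case: (n) nk0 => //; rewrite mul0r ler10.
  have c0 : 0 < 2 / (2 + g) * 2 by rewrite mulr_gt0// divr_gt0.
  have nV0 : 0 < n%:R^-1 :> R by rewrite invr_gt0.
  have [k1 small] := dyadic_powR_small c0 nV0.
  exists (maxn k0 k1); rewrite /p leq_maxl/= -ltr_pdivlMl// mulr1.
  rewrite -powR_mulrn ?powR_ge0// /level_scale -powRrM.
  by apply: small; exact: leq_maxr.
case: (ex_minnP exp0) => m /andP[k0m nm] mmin.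
have k0m' : (k0 < m)%N.
  rewrite ltn_neqAle k0m andbT; apply: contraL nk0 => /eqP ->.
  by rewrite -ltNge.
case: m k0m' {k0m} nm mmin => // K k0K nK mmin; exists K; split => //.
rewrite leNgt; apply/negP => nK'.
by have := mmin K; rewrite /p nK' -ltnS k0K/= => /(_ isT); rewrite ltnn.
Qed.

(** Failure at level K+1 bounds [sqrt n] by the inverse of [theta_(K+1)], and
    [eps_K] is [theta_K] times the power [g / (2 + g)] of [eps_K]. *)
Lemma bias_at_finest_level (n K : nat) : n%:R * level_scale g K.+1 ^+ 2 < 1 ->
  Num.sqrt n%:R * dyadic K <= scale_ratio g * dyadic K `^ (g / (2 + g)).
Proof.
move=> nK.
have d0 : 0 < dyadic K :> R by rewrite exprn_gt0// invr_gt0.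
rewrite [X in _ * X <= _](_ : dyadic K = level_scale g K * dyadic K `^ (g / (2 + g))); last first.
  rewrite /level_scale -powRD ?(lt0r_neq0 d0) ?implybT//.
  rewrite (_ : _ + _ = 1) ?powRr1 ?(ltW d0)//.
  by field; rewrite gt_eqF.
rewrite mulrA ler_wpM2r ?powR_ge0// level_scaleS// mulrCA ler_piMr//.
  exact: powR_ge0.
rewrite -(@ler_pXn2r _ 2)// ?nnegrE ?mulr_ge0 ?sqrtr_ge0 ?powR_ge0//.
by rewrite exprMn sqr_sqrtr// expr1n ltW.
Qed.

End fine_level.

Section outer_expectation_bound.
Context {R : realType} {dO dS : measure_display}.
Context {Omega : measurableType dO} {S : measurableType dS}.
Variables (P : probability Omega R) (X : nat -> nat -> Omega -> S).
Variables (F : set (S -> R)) (g : R) (Q : nat).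
Hypothesis g0 : 0 < g.
Hypothesis Q2 : (2 <= Q)%N.

Lemma array_dist_refl (phi : S -> R) : (array_dist P X Q g phi phi <= 0)%E.
Proof.
have Q0 : 0 < Q%:R :> R by rewrite ltr0n (leq_trans _ Q2).
have g2 : 0 < 2 + g by rewrite addr_gt0.
apply: ge_ereal_sup => _ [[n t] _ <-] /=.
rewrite (_ : (fun w => _) = cst 0); last first.
  apply/funext => w; rewrite subrr normr0 powR0// mulf_neq0 ?lt0r_neq0//.
  by rewrite divr_gt0.
by rewrite expectation_cst poweR0r// mulf_neq0 ?lt0r_neq0 ?invr_gt0 ?divr_gt0.
Qed.

Definition oscillation (n : nat) (delta : R) (w : Omega) : \bar R :=
  ereal_sup [set (`|empirical_process P X n 1 pp.1 w
                        - empirical_process P X n 1 pp.2 w| ^+ Q)%R%:E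
                | pp in [set pp : (S -> R) * (S -> R) |
                    [/\ F pp.1, F pp.2 &
                        (array_dist P X Q g pp.1 pp.2 < delta%:E)%E ] ] ].

(** The power of U is a measurable majorant.  If F is empty the outer
    expectation is -oo and its root is 0; otherwise the pairs (phi, phi) make
    it nonnegative. *)
Lemma outer_expectation_le n delta (U : Omega -> R) (c : R) : 0 < delta -> 0 <= c ->
  (forall w, 0 <= U w) -> Lnorm_le P Q U c ->
  (forall phi psi, F phi -> F psi -> (array_dist P X Q g phi psi < delta%:E)%E ->
      forall w, `|empirical_process P X n 1 phi w
                  - empirical_process P X n 1 psi w| <= U w) ->
  (outer_expectation P (oscillation n delta) `^ Q%:R^-1 <= c%:E)%E.
Proof.
move=> d0 c0 U0 [mU LU] osc.
have Q0 : (0 < Q)%N by rewrite (leq_trans _ Q2).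
have Qr0 : 0 < Q%:R :> R by rewrite ltr0n.
have -> : c%:E = ((c ^+ Q)%:E `^ (Q%:R)^-1)%E.
  by rewrite -powR_mulrn// poweR_EFin -powRrM mulfV ?lt0r_neq0// powRr1.
have intU := (Lnorm_leP P Q0 U c0).1 LU.
have UQ : (outer_expectation P (oscillation n delta) <= (c ^+ Q)%:E)%E.
  apply: le_trans intU.
  apply: ereal_inf_lbound; exists (fun w => (`|U w| ^+ Q)%:E) => //; split.
  - apply/measurable_EFinP; apply: measurable_funX.
    exact: measurableT_comp.
  - right; rewrite (eq_integral (cst 0%E)) ?integral0// => w _.
    by rewrite funenegE; apply/max_idPr; rewrite -EFinN lee_fin oppr_le0 exprn_ge0.
  - move=> w; apply: ge_ereal_sup => _ [[phi psi]/= [Fphi Fpsi dist] <-].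
    rewrite lee_fin lerXn2r ?nnegrE//.
    by rewrite (le_trans (osc _ _ Fphi Fpsi dist w))// ler_norm.
apply: poweR_le_of_nonneg => //; first by rewrite invr_gt0.
  have [[phi Fphi]|noF] := pselect (exists phi, F phi).
    right; apply: le_ereal_inf_tmp => _ [V [_ _ ZV] <-].
    apply: integral_ge0 => w _; apply: le_trans (ZV w).
    apply: le_ereal_sup_tmp.
    exists (`|empirical_process P X n 1 phi w
              - empirical_process P X n 1 phi w| ^+ Q)%:E.
      exists (phi, phi) => //; split=> //=.
      by rewrite (le_lt_trans (array_dist_refl _))// lte_fin.
    by rewrite lee_fin exprn_ge0.
  left; apply/eqP; rewrite -leeNy_eq; apply: ereal_inf_lbound.
  exists (fun=> -oo%E); last first.
    by rewrite integral_cst// [X in (_ * X)%E](probability_setT P) mule1.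
  split => //.
  - left; rewrite (eq_integral (cst 0%E)) ?integral0 ?ltry// => w _.
    by rewrite funeposE maxNye.
  - by move=> w; apply: ge_ereal_sup => x [[phi psi]/= [Fphi _ _] _]; case: noF; exists phi.
by rewrite lee_fin exprn_ge0.
Qed.

End outer_expectation_bound.

Section levels.
Context {R : realType} {dO dS : measure_display}.
Context {Omega : measurableType dO} {S : measurableType dS}.
Variables (P : probability Omega R) (X : nat -> nat -> Omega -> S).
Hypothesis X_meas : forall n t, (1 <= t <= n)%N -> measurable_fun setT (X n t).
Variables (F : set (S -> R)) (gamma : R) (Q : nat).
Hypothesis gamma_gt0 : 0 < gamma.
Hypothesis A2_bounding : forall eps : R, (0 < eps)%R ->
     exists (N : nat) (B A : set (S -> R)),
     [/\ bracketing_number eps F (array_rho P X) = N%:R%:E,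
         bracketing_classes eps F (array_rho P X) N B A &
         forall (i : nat) (b : S -> R), (2 <= i <= Q)%N -> B b ->
           (array_sup (fun n t =>
             'E_P[fun w => (`|b (X n t w)| `^ (i%:R * ((2 + gamma) / 2)))%R]
               `^ (2^-1)%R) <= eps%:E)%E].

(** The classes of the second part of the entropy condition, enumerated at all
    dyadic levels at once. *)
Lemma bracketing_levels : exists (N : nat -> nat)
    (a b : forall k, 'I_(N k) -> S -> R),
  [/\ forall k, bracketing_number (dyadic k) F (array_rho P X) = (N k)%:R%:E,
      forall k i, F (a k i),
      forall k j, measurable_fun setT (b k j) /\
        forall n (h : S -> R), measurable_fun setT h ->
        (forall x, `|h x| <= `|b k j x|) ->
        row_moments P X gamma Q n h (level_scale gamma k),
      forall k j n t, (1 <= t <= n)%N ->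
        intble P (fun w => b k j (X n t w)) /\
        Ex P (fun w => `|b k j (X n t w)|) <= dyadic k &
      forall k phi, F phi ->
        exists i j, forall x, `|phi x - a k i x| <= b k j x].
Proof.
have dy0 k : 0 < dyadic k :> R by rewrite exprn_gt0// invr_gt0.
pose pack := {N : nat & (('I_N -> S -> R) * ('I_N -> S -> R))%type}.
have /choice[f fP] : forall k, exists p : pack,
   [/\ bracketing_number (dyadic k) F (array_rho P X) = (projT1 p)%:R%:E,
      forall i, F ((projT2 p).1 i),
      forall j, measurable_fun setT ((projT2 p).2 j) /\
        forall n (h : S -> R), measurable_fun setT h ->
        (forall x, `|h x| <= `|(projT2 p).2 j x|) ->
        row_moments P X gamma Q n h (level_scale gamma k),
      forall j n t, (1 <= t <= n)%N ->
        intble P (fun w => (projT2 p).2 j (X n t w)) /\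
        Ex P (fun w => `|(projT2 p).2 j (X n t w)|) <= dyadic k &
      forall phi, F phi ->
        exists i j, forall x, `|phi x - (projT2 p).1 i x| <= (projT2 p).2 j x].
  move=> k; have [N [B [A [NE [[Bm AF] [cB cA] rB cov] Bmom]]]] := A2_bounding (dy0 k).
  have [a [aA aS]] := enum_of_card cA; have [b [bB bS]] := enum_of_card cB.
  exists (existT _ N (a, b)); split => //=.
  - by move=> i; exact: AF.
  - move=> j; split=> [|n h mh hb]; first exact: Bm.
    apply: (row_moments_bounding X_meas gamma_gt0 n (b := b j)) => //.
      exact: Bm.
    by move=> i iQ; exact: Bmom.
  - by move=> j n t tn; apply: (bracket_mean X_meas (dy0 k) tn); [exact: Bm|exact: rB].
  - move=> phi /cov[a' [b' [/aS[i <-] /bS[j <-] h]]]; by exists i, j.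
exists (fun k => projT1 (f k)), (fun k => (projT2 (f k)).1), (fun k => (projT2 (f k)).2).
by split=> k; case: (fP k).
Qed.

End levels.

Local Open Scope ereal_scope.

Theorem theorem2p5 (R : realType) (dO dS : measure_display)
  (Omega : measurableType dO) (S : measurableType dS)
  (P : probability Omega R) (X : nat -> nat -> Omega -> S)
  (F : set (S -> R)) (gamma : R) (Q : nat)
  (X_meas : forall n t, (1 <= t <= n)%N -> measurable_fun setT (X n t))
  (F_meas : forall phi, F phi -> measurable_fun setT phi)
  (F_int : forall phi n t, F phi -> (1 <= t <= n)%N ->
     'E_P[fun w => `|phi (X n t w)|%R] < +oo)
  (gamma_gt0 : (0 < gamma)%R) (Q_ge2 : (2 <= Q)%N) (Q_even : ~~ odd Q)
  (A1_mixing : strongly_mixing P X)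
  (A1_sum : \sum_(1 <= t <oo)
     (t%:R ^+ (Q - 2))%:E * alpha_mixing P X t `^ (gamma / (2 + gamma))%R < +oo)
  (A2_entropy : \int[lebesgue_measure]_(x in `]0%R, 1%R])
     ((x `^ (- (gamma / (2 + gamma))))%R%:E *
      bracketing_number x F (array_rho P X) `^ (Q%:R^-1)%R) < +oo)
  (A2_bounding : forall eps : R, (0 < eps)%R ->
     exists (N : nat) (B A : set (S -> R)),
     [/\ bracketing_number eps F (array_rho P X) = N%:R%:E,
         bracketing_classes eps F (array_rho P X) N B A &
         forall (i : nat) (b : S -> R), (2 <= i <= Q)%N -> B b ->
           array_sup (fun n t =>
             'E_P[fun w => (`|b (X n t w)| `^ (i%:R * ((2 + gamma) / 2)))%R]
               `^ (2^-1)%R) <= eps%:E]) :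
  limn_esup (fun n =>
    outer_expectation P (fun w =>
      ereal_sup [set (`|empirical_process P X n 1 pp.1 w
                        - empirical_process P X n 1 pp.2 w| ^+ Q)%R%:E
                | pp in [set pp : (S -> R) * (S -> R) |
                    [/\ F pp.1, F pp.2 &
                        array_dist P X Q gamma pp.1 pp.2 < delta%:E] ] ])
      `^ (Q%:R^-1)%R) @[delta --> (0 : R)%R^'+] --> (0 : \bar R).
Proof.
have [W W0 rate_sum] := mix_rate_sum X_meas A1_sum.
have [N [a [b [NE aF b_row b_mean bracket]]]] :=
  bracketing_levels X_meas gamma_gt0 A2_bounding.
have F_intble phi n t : F phi -> (1 <= t <= n)%N -> intble P (fun w => phi (X n t w)).
  move=> Fphi tn; apply/integrableP; split.
    by apply/measurable_EFinP; apply: measurableT_comp; [exact: F_meas|exact: X_meas].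
  by have := F_int phi n t Fphi tn; rewrite unlock.
have [cE sumE] := entropy_sum_bounded gamma_gt0 NE A2_entropy.
pose C := empirical_const gamma Q W.
have C0 : (0 <= C)%R by exact: empirical_const_ge0.
pose u k := entropy_term gamma Q N k.
have u0 k : (0 <= u k)%R by exact: entropy_term_ge0.
pose rho : R := scale_ratio gamma.
have rho1 : (1 <= rho)%R by exact: scale_ratio_ge1.
apply: cvge_right0 => [delta|e e0].
  apply: limf_esup_ge0 => [|n]; last exact: poweR_ge0.
  by case=> n _ /(_ n (leqnn n)).
(* four chains, each of at most (C rho + C + 2) eta, and eta for the pairs *)
pose D : R := (4 * (C * rho + C + 2) + 1)%R.
have D0 : (0 < D)%R.
  by rewrite ltr_wpDl// mulr_ge0// !addr_ge0// mulr_ge0// (le_trans ler01).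
pose eta : R := (e / D)%R.
have eta0 : (0 < eta)%R by rewrite divr_gt0.
have [k1 tail] := bounded_series_tail u0 sumE eta0.
have kappa0 : (0 < gamma / (2 + gamma))%R by rewrite divr_gt0// addr_gt0.
have rho0 : (0 < rho)%R by rewrite (lt_le_trans ltr01).
have [k2 small] := dyadic_powR_small kappa0 (divr_gt0 eta0 rho0).
pose k0 := maxn k1 k2.
(* the cost of the pairs of level k0, per unit of delta *)
pose c0 : R := ((N k0 * N k0)%:R `^ Q%:R^-1 * (C * 2))%R.
have c00 : (0 <= c0)%R by rewrite mulr_ge0 ?powR_ge0// mulr_ge0.
exists (Num.min 1 (eta / (c0 + 1)))%R.
  by rewrite lt_min ltr01 divr_gt0// ltr_wpDl.
move=> delta /andP[d0]; rewrite lt_min => /andP[d1 dc].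
have th0 k : (0 < level_scale gamma k)%R by exact: level_scale_gt0.
pose n1 := (Num.truncn ((level_scale gamma k0 ^+ 2)^-1)%R).+1.
pose n2 := (Num.truncn (((2 * delta) ^+ 2)^-1)%R).+1.
have big (x : R) n : (0 < x)%R -> ((Num.truncn x^-1%R).+1 <= n)%N -> (1 <= n%:R * x)%R.
  move=> x0 xn; rewrite -ler_pdivrMr// mul1r ltW// (lt_le_trans (truncnS_gt _))//.
  by rewrite ler_nat.
apply: (@limn_esup_le_eventually _ _ _ (maxn n1 n2)) => n.
rewrite geq_max => /andP[n1n n2n].
have n0 : (0 < n)%N by rewrite (leq_trans _ n1n).
have nk0 : (1 <= n%:R * level_scale gamma k0 ^+ 2)%R by apply: big => //; exact: exprn_gt0.
have [K [k0K nK nKS]] := finest_level gamma_gt0 nk0.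
have nd : (1 <= n%:R * (2 * delta) ^+ 2)%R.
  by apply: big => //; rewrite exprn_gt0// mulr_gt0.
have d01 : (0 < delta <= 1)%R by rewrite d0 ltW.
have [U [U0 LU oscU]] := chaining_bound X_meas gamma_gt0 Q_ge2 Q_even W0 rate_sum
  F_meas F_intble aF (fun k j => (b_row k j).1) (fun k j => (b_row k j).2) b_mean bracket n0 k0K nK d01 nd.
have tailK : (\sum_(k1 <= k < K.+1) u k <= eta)%R by exact: tail.
have k1K : (k1 <= K)%N by rewrite (leq_trans (leq_maxl k1 k2)).
have uK : (u K <= eta)%R.
  apply: le_trans tailK; rewrite big_nat_recr//= lerDr.
  by apply: sumr_ge0 => k _.
have chainK : (\sum_(k0 <= k < K) u k.+1 <= eta)%R.
  apply: le_trans tailK.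
  rewrite (_ : \sum_(k0 <= k < K) u k.+1 = \sum_(k0.+1 <= k < K.+1) u k)%R; last first.
    by rewrite big_add1.
  rewrite [leRHS](@big_cat_nat _ _ _ k0.+1)//=; last first.
    by rewrite (leq_trans (leq_maxl k1 k2)).
  by rewrite lerDr; apply: sumr_ge0 => k _.
have biasK : (Num.sqrt n%:R * dyadic K <= eta)%R.
  apply: (le_trans (bias_at_finest_level gamma_gt0 nKS)).
  have k2K : (k2 <= K)%N by rewrite (leq_trans (leq_maxr k1 k2)).
  by rewrite -/rho mulrC -ler_pdivlMr// ltW// small.
apply: (outer_expectation_le gamma_gt0 Q_ge2 d0 (ltW e0) U0 _ oscU).
apply: Lnorm_le_trans LU.
have eE : e = (D * eta)%R by rewrite /eta mulrC divfK ?gt_eqF.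
rewrite [leRHS]eE /D [leRHS]mulrDl mul1r lerD//.
  rewrite -mulrA ler_pM2l// /chain_bound.
  rewrite (_ : (C * rho + C + 2) * eta = C * rho * eta + (C * eta + 2 * eta))%R; last by ring.
  apply: lerD.
    by rewrite ler_wpM2l// mulr_ge0// (le_trans ler01).
  by apply: lerD; rewrite ler_wpM2l.
have -> : ((N k0 * N k0)%:R `^ Q%:R^-1 * (C * (2 * delta)) = c0 * delta)%R.
  by rewrite /c0; ring.
apply: (@le_trans _ _ ((c0 + 1) * (eta / (c0 + 1)))%R).
  by apply: ler_pM => //; [exact: ltW|rewrite lerDl|exact: ltW].
by rewrite mulrC divfK// gt_eqF// ltr_wpDl.
Qed.
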